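(* Let $\alpha$ be an ordinal with a ptime representation $\mathfrak{O}$, and let $\Gamma(\bar{x}) \cup \Delta(\bar{x})$ be a finite multiset of $\forall_1$-formulas. Then $\mathrm{TI}(\forall_1, \prec) \vdash \bigwedge \Gamma(\bar{x}) \rightarrow \bigvee \Delta(\bar{x})$ if and only if $\Gamma(\bar{x}) \rhd_{\alpha} \Delta(\bar{x})$.
   Context: $\mathcal{L}_{\mathrm{PV}}$ is the first-order language having a function symbol for every polynomial-time algorithm given by Cobham's characterization (composition and bounded recursion on notation from basic functions); $\mathrm{PV}$ denotes Cook's universal theory of polynomial-time functions in its first-order form ($\mathrm{PV}_1$) over $\mathcal{L}_{\mathrm{PV}}$. Formulas are built from atomic formulas, their negations, $\bot,\top$ using $\wedge,\vee,\forall,\exists$; $\neg A$ is defined by de Morgan laws and $A\to B$ abbreviates $\neg A \vee B$. A ptime representation of an infinite ordinal $\alpha$ closed under $+$, $\cdot$ and $\beta\mapsto\omega^\beta$ is a tuple $(\mathcal{O},\prec,+,\cdot,\dotminus,d,o,x\mapsto\omega^x,\mathbf{0},\mathbf{1},\omega)$ where $\mathcal{O}(x)$ and $x\prec y$ are quantifier-free $\mathcal{L}_{\mathrm{PV}}$-formulas, $+,\cdot,\dotminus$ (left subtraction), $d$ (left division), $o$ are $\mathcal{L}_{\mathrm{PV}}$-terms, $x\mapsto \omega^x$ is a primitive recursive function, $\mathbf{0},\mathbf{1},\omega$ are numbers, such that $(\mathcal{O},\prec)\cong(\alpha,<)$; $\mathrm{PV}$ proves: $\prec$ is a total order on $\mathcal{O}$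 with minimum $\mathbf{0}$; discreteness ($\gamma\prec\beta+\mathbf{1}$ implies $\gamma\prec\beta$ or $\gamma=\beta$); associativity of $+,\cdot$, left distributivity, neutrality of $\mathbf{0}$ for $+$ and $\mathbf{1}$ for $\cdot$, $\mathbf{0}\beta=\beta\mathbf{0}=\mathbf{0}$; $\delta\prec\gamma$ implies $\beta+\delta\prec\beta+\gamma$ and (for $\beta\neq\mathbf{0}$) $\beta\delta\prec\beta\gamma$; $\delta\preceq\gamma$ implies $\delta+\beta\preceq\gamma+\beta$ and $\delta\beta\preceq\gamma\beta$; if $\alpha'\prec\beta$ then $\alpha'\dotminus\beta=\mathbf{0}$ and if $\alpha'\succeq\beta$ then $\alpha'=\beta+(\alpha'\dotminus\beta)$; if $\beta\neq\mathbf{0}$ then $\beta d(\alpha',\beta)\preceq\alpha'$ and $\alpha'\dotminus\beta d(\alpha',\beta)\prec\beta$; $o$ is an order-isomorphism from the natural numbers onto the elements of $\mathcal{O}$ below $\omega$ with $o(0)=\mathbf{0}$, $o(1)=\mathbf{1}$; moreover (in $\mathrm{PRA}$) $\omega^{\mathbf{0}}=\mathbf{1}$, $\omega^{\mathbf{1}}=\omega$, $\omega^x$ is monotone and maps addition to multiplication, $\omega^\beta$ is the supremum of $\{\omega^\gamma:\gamma\prec\beta\}$ for limit $\beta$, and every $\beta$ has a unique Cantor normal form. Greek-letter quantifiers range over $\mathcal{O}$ (e.g. $\forall\beta\,A(\beta)$ means $\forall x(\mathcal{O}(x)\to A(x))$); numerals and their images under $o$ are identified. $\forall_1$ is the least class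 of $\mathcal{L}_{\mathrm{PV}}$-formulas containing atomic formulas and their negations and closed under $\wedge$, $\vee$, and universal quantification. $\mathrm{TI}(\forall_1,\prec)$ is $\mathrm{PV}$ extended by the scheme $\forall\delta(\forall\gamma\prec\delta\, A(\gamma)\to A(\delta))\to A(\theta)$ for every $A(\gamma)\in\forall_1$ and every constant $\theta\in\mathcal{O}$. For $A(\bar{x}),B(\bar{x})\in\forall_1$, an $\alpha$-flow from $A$ to $B$ is a pair $(H(\gamma,\bar{x}),\beta)$ with $H\in\forall_1$, $\beta\in\mathcal{O}$, $\beta\succeq 1$, such that $\mathrm{PV}\vdash A(\bar{x})\leftrightarrow H(0,\bar{x})$, $\mathrm{PV}\vdash\forall\,1\preceq\delta\preceq\beta\,[\forall\gamma\prec\delta\,H(\gamma,\bar{x})\to H(\delta,\bar{x})]$, and $\mathrm{PV}\vdash H(\beta,\bar{x})\leftrightarrow B(\bar{x})$. $A\rhd_\alpha B$ means such a flow exists; for multisets, $\Gamma\rhd_\alpha\Delta$ means $\bigwedge\Gamma\rhd_\alpha\bigvee\Delta$. *)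

(* Defs.v *)
From mathcomp Require Import all_boot.
From Stdlib Require List.
Set Implicit Arguments.
Unset Strict Implicit.
Unset Printing Implicit Defensive.

(** * Finite argument lists *)

Definition anil {T : Type} (i : 'I_0) : T :=
  match i with Ordinal _ h => False_rect T (Bool.diff_false_true h) end.

Definition acons {T : Type} {n : nat} (a : T) (v : 'I_n -> T) (i : 'I_n.+1) : T :=
  match i with
  | Ordinal m h =>
      (match m return m < n.+1 -> T with
       | 0 => fun _ => a
       | j.+1 => fun h => v (@Ordinal n j h)
       end) h
  end.

Notation "'[args' ]" := anil (at level 0, format "[args ]").
Notation "'[args' x1 ; .. ; xn ]" := (acons x1 .. (acons xn anil) ..)
  (at level 0, format "[args  x1 ;  .. ;  xn ]").

(** * First-order logic with equality, in negation normal form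

    A signature gives the function symbols of each arity; equality is the only
    relation symbol.  Variables are de Bruijn indices: [All A] and [Ex A] bind
    index 0 of [A]. *)

Inductive term (S : nat -> Type) : Type :=
| Var (i : nat)
| App (n : nat) (f : S n) (v : 'I_n -> term S).
Arguments Var {S} i.
Arguments App {S n} f v.

Inductive form (S : nat -> Type) : Type :=
| Top
| Bot
| Eq (s t : term S)
| Neq (s t : term S)
| And (A B : form S)
| Or (A B : form S)
| All (A : form S)
| Ex (A : form S).
Arguments Top {S}.
Arguments Bot {S}.

Fixpoint neg (S : nat -> Type) (A : form S) : form S :=
  match A with
  | Top => Bot
  | Bot => Top
  | Eq s t => Neq s t
  | Neq s t => Eq s t
  | And A B => Or (neg A) (neg B)
  | Or A B => And (neg A) (neg B)
  | All A => Ex (neg A)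
  | Ex A => All (neg A)
  end.

Definition Imp (S : nat -> Type) (A B : form S) : form S := Or (neg A) B.
Definition Iff (S : nat -> Type) (A B : form S) : form S := And (Imp A B) (Imp B A).

Definition bigAnd (S : nat -> Type) (G : seq (form S)) : form S := foldr (@And S) Top G.
Definition bigOr (S : nat -> Type) (G : seq (form S)) : form S := foldr (@Or S) Bot G.

Declare Scope fol_scope.
Delimit Scope fol_scope with F.
Bind Scope fol_scope with form.
Notation "s ≈ t" := (Eq s t) (at level 70, no associativity) : fol_scope.
Notation "s ≉ t" := (Neq s t) (at level 70, no associativity) : fol_scope.
Notation "A ∧ B" := (And A B) (at level 80, right associativity) : fol_scope.
Notation "A ∨ B" := (Or A B) (at level 85, right associativity) : fol_scope.
Notation "A ⟶ B" := (Imp A B) (at level 90, right associativity) : fol_scope.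
Notation "A ⟷ B" := (Iff A B) (at level 95, no associativity) : fol_scope.

(** ** Substitution *)

Definition scons (X : Type) (t : X) (s : nat -> X) (i : nat) : X :=
  if i is j.+1 then s j else t.

Fixpoint tsubst (S : nat -> Type) (s : nat -> term S) (t : term S) : term S :=
  match t with
  | Var i => s i
  | App n f v => App f (fun j => tsubst s (v j))
  end.

Definition tshift (S : nat -> Type) : term S -> term S := tsubst (fun i => Var i.+1).

Definition up (S : nat -> Type) (s : nat -> term S) : nat -> term S :=
  scons (Var 0) (fun i => tshift (s i)).

Fixpoint fsubst (S : nat -> Type) (s : nat -> term S) (A : form S) : form S :=
  match A with
  | Top => Top
  | Bot => Bot
  | Eq t u => Eq (tsubst s t) (tsubst s u)
  | Neq t u => Neq (tsubst s t) (tsubst s u)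
  | And A B => And (fsubst s A) (fsubst s B)
  | Or A B => Or (fsubst s A) (fsubst s B)
  | All A => All (fsubst (up s) A)
  | Ex A => Ex (fsubst (up s) A)
  end.

Definition fshift (S : nat -> Type) : form S -> form S := fsubst (fun i => Var i.+1).

(** [finst A t] is A(t, y0, y1, ...) for A = A(x, y0, y1, ...), eliminating the
    variable x = [Var 0]. *)
Definition finst (S : nat -> Type) (A : form S) (t : term S) : form S :=
  fsubst (scons t Var) A.

(** A(s, t), u(s) and u(s, t) for A = A(x, y), u = u(x) and u = u(x, y), where
    x = [Var 0] and y = [Var 1]. *)
Definition fapp2 (S : nat -> Type) (A : form S) (s t : term S) : form S :=
  fsubst (scons s (scons t Var)) A.
Definition tapp1 (S : nat -> Type) (u : term S) (s : term S) : term S :=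
  tsubst (scons s Var) u.
Definition tapp2 (S : nat -> Type) (u : term S) (s t : term S) : term S :=
  tsubst (scons s (scons t Var)) u.

(** ** Syntactic classes *)

(** All free variables are among [Var 0], ..., [Var n.-1]. *)
Fixpoint tscoped (S : nat -> Type) (n : nat) (t : term S) : Prop :=
  match t with
  | Var i => i < n
  | App m f v => forall j, tscoped n (v j)
  end.

Fixpoint fscoped (S : nat -> Type) (n : nat) (A : form S) : Prop :=
  match A with
  | Top | Bot => True
  | Eq s t | Neq s t => tscoped n s /\ tscoped n t
  | And A B | Or A B => fscoped n A /\ fscoped n B
  | All A | Ex A => fscoped n.+1 A
  end.

Inductive qfree (S : nat -> Type) : form S -> Prop :=
| qf_top : qfree Top
| qf_bot : qfree Bot
| qf_eq s t : qfree (Eq s t)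
| qf_neq s t : qfree (Neq s t)
| qf_and A B : qfree A -> qfree B -> qfree (And A B)
| qf_or A B : qfree A -> qfree B -> qfree (Or A B).

(** The class ∀₁; the constants ⊤ and ⊥ count as atomic. *)
Inductive forall1 (S : nat -> Type) : form S -> Prop :=
| f1_top : forall1 Top
| f1_bot : forall1 Bot
| f1_eq s t : forall1 (Eq s t)
| f1_neq s t : forall1 (Neq s t)
| f1_and A B : forall1 A -> forall1 B -> forall1 (And A B)
| f1_or A B : forall1 A -> forall1 B -> forall1 (Or A B)
| f1_all A : forall1 A -> forall1 (All A).

(** ** Derivability

    One-sided (Tait) sequent calculus with cut; a sequent stands for the
    disjunction of its members.  Members of [T] may be open and are read as
    universally closed: an axiom enters without side formulas, so [pr_all]
    applies to it. *)
Inductive prov (S : nat -> Type) (T : form S -> Prop) : seq (form S) -> Prop :=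
| pr_ax A : T A -> prov T [:: A]
| pr_id A : prov T [:: neg A; A]
| pr_top : prov T [:: Top]
| pr_refl t : prov T [:: Eq t t]
| pr_leibniz A s t : prov T [:: Neq s t; neg (finst A s); finst A t]
| pr_and A B G : prov T (A :: G) -> prov T (B :: G) -> prov T (And A B :: G)
| pr_or A B G : prov T (A :: B :: G) -> prov T (Or A B :: G)
| pr_all A G : prov T (A :: map (@fshift S) G) -> prov T (All A :: G)
| pr_ex A t G : prov T (finst A t :: G) -> prov T (Ex A :: G)
| pr_cut A G : prov T (A :: G) -> prov T (neg A :: G) -> prov T G
| pr_weak G D : prov T G -> (forall A, List.In A G -> List.In A D) -> prov T D.

Definition proves (S : nat -> Type) (T : form S -> Prop) (A : form S) : Prop :=
  prov T [:: A].

(** ** Interpretations over the natural numbers *)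

Fixpoint teval (S : nat -> Type) (I : forall n, S n -> ('I_n -> nat) -> nat)
    (e : nat -> nat) (t : term S) : nat :=
  match t with
  | Var i => e i
  | App n f v => I n f (fun j => teval I e (v j))
  end.

Fixpoint holds (S : nat -> Type) (I : forall n, S n -> ('I_n -> nat) -> nat)
    (e : nat -> nat) (A : form S) : Prop :=
  match A with
  | Top => True
  | Bot => False
  | Eq s t => teval I e s = teval I e t
  | Neq s t => teval I e s <> teval I e t
  | And A B => holds I e A /\ holds I e B
  | Or A B => holds I e A \/ holds I e B
  | All A => forall x, holds I (scons x e) A
  | Ex A => exists x, holds I (scons x e) A
  end.

(** ** Translation along a map of signatures *)

Fixpoint tmap (S S' : nat -> Type) (m : forall n, S n -> S' n) (t : term S) : term S' :=
  match t with
  | Var i => Var i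
  | App n f v => App (m n f) (fun j => tmap m (v j))
  end.

Fixpoint fmap (S S' : nat -> Type) (m : forall n, S n -> S' n) (A : form S) : form S' :=
  match A with
  | Top => Top
  | Bot => Bot
  | Eq s t => Eq (tmap m s) (tmap m t)
  | Neq s t => Neq (tmap m s) (tmap m t)
  | And A B => And (fmap m A) (fmap m B)
  | Or A B => Or (fmap m A) (fmap m B)
  | All A => All (fmap m A)
  | Ex A => Ex (fmap m A)
  end.

(** * The language of PV

    Cobham's polynomial-time algorithms on dyadic words, with Cook's initial
    functions: a number is identified with the word of its dyadic digits 1 and
    2, so that 0 is the empty word and [PvS1], [PvS2] (x ↦ 2x+1, x ↦ 2x+2)
    append a digit.  [PvTr] deletes the last digit, [PvCat] is concatenation,
    [PvSmash] concatenates |y| copies of x, and [PvLess] deletes the last |y|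
    digits of x.

    [PvRec g h1 h2 k] is the function f given from g, h1, h2 by recursion on
    notation bounded by k:
      f(0, y) = g(y),   f(s_i x, y) = h_i(x, f(x, y), y).
    The bound |f(x, y)| <= |k(x, y)| is enforced by cutting every value to the
    length of the bound (as in Ferreira's PTCA); this changes nothing when
    Cobham's proviso f <= k holds. *)
Inductive pv : nat -> Type :=
| PvZero : pv 0
| PvS1 : pv 1
| PvS2 : pv 1
| PvTr : pv 1
| PvCat : pv 2
| PvSmash : pv 2
| PvLess : pv 2
| PvProj (n : nat) (i : 'I_n) : pv n
| PvComp (n m : nat) (f : pv m) (g : 'I_m -> pv n) : pv n
| PvRec (n : nat) (g : pv n) (h1 h2 : pv n.+2) (k : pv n.+1) : pv n.+1.

Definition zero : term pv := App PvZero [args].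
Definition sc1 (t : term pv) : term pv := App PvS1 [args t].
Definition sc2 (t : term pv) : term pv := App PvS2 [args t].
Definition tr (t : term pv) : term pv := App PvTr [args t].
Definition cat2 (s t : term pv) : term pv := App PvCat [args s; t].
Definition smash (s t : term pv) : term pv := App PvSmash [args s; t].
Definition less (s t : term pv) : term pv := App PvLess [args s; t].

(** The first min(|s|, |t|) digits of s. *)
Definition cut (s t : term pv) : term pv := less s (less s t).

(** ** Standard model *)

Fixpoint dyadic_rec_fuel (X : Type) (fuel : nat) (b : X) (s : bool -> nat -> X -> X)
    (x : nat) : X :=
  match fuel, x with
  | k.+1, y.+1 => s (odd y) y./2 (dyadic_rec_fuel k b s y./2)
  | _, _ => b
  end.

(** Recursion on dyadic notation: the digit d is [false] for x = 2z+1 and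
    [true] for x = 2z+2, and s d z r is the value at x if r is that at z. *)
Definition dyadic_rec (X : Type) (b : X) (s : bool -> nat -> X -> X) (x : nat) : X :=
  dyadic_rec_fuel x b s x.

Definition dsucc (d : bool) (x : nat) : nat := if d then x.*2.+2 else x.*2.+1.
Definition dtr (x : nat) : nat := x.-1./2.
Definition dcat (x y : nat) : nat := dyadic_rec x (fun d _ r => dsucc d r) y.
Definition dsmash (x y : nat) : nat := dyadic_rec 0 (fun _ _ r => dcat x r) y.
Definition dless (x y : nat) : nat := dyadic_rec x (fun _ _ r => dtr r) y.
Definition dcut (x y : nat) : nat := dless x (dless x y).

Fixpoint pv_std (n : nat) (f : pv n) : ('I_n -> nat) -> nat :=
  match f in pv n return ('I_n -> nat) -> nat with
  | PvZero => fun _ => 0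
  | PvS1 => fun v => dsucc false (v ord0)
  | PvS2 => fun v => dsucc true (v ord0)
  | PvTr => fun v => dtr (v ord0)
  | PvCat => fun v => dcat (v ord0) (v ord_max)
  | PvSmash => fun v => dsmash (v ord0) (v ord_max)
  | PvLess => fun v => dless (v ord0) (v ord_max)
  | PvProj n i => fun v => v i
  | PvComp n m f g => fun v => pv_std f (fun j => pv_std (g j) v)
  | PvRec n g h1 h2 k => fun v =>
      let y := fun j : 'I_n => v (lift ord0 j) in
      dyadic_rec (dcut (pv_std g y) (pv_std k (acons 0 y)))
        (fun d x r =>
           dcut (pv_std (if d then h2 else h1) (acons x (acons r y)))
                (pv_std k (acons (dsucc d x) y)))
        (v ord0)
  end.

Definition num (n : nat) : term pv :=
  dyadic_rec zero (fun d _ t => if d then sc2 t else sc1 t) n.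

Definition std (A : form pv) (e : nat -> nat) : Prop := holds pv_std e A.

(** ** The theory PV

    The defining equations of the function symbols, closed under induction on
    notation for quantifier-free formulas (as a rule, so that the theory is
    universal).  [pv_ind_rule] passes from A(0), A(x) → A(2x+1) and
    A(x) → A(2x+2) to A(x), with x = [Var 0]. *)
Inductive PV : form pv -> Prop :=
| pv_s1_neq0 t : PV (sc1 t ≉ zero)%F
| pv_s2_neq0 t : PV (sc2 t ≉ zero)%F
| pv_s1_neq_s2 s t : PV (sc1 s ≉ sc2 t)%F
| pv_tr0 : PV (tr zero ≈ zero)%F
| pv_tr1 t : PV (tr (sc1 t) ≈ t)%F
| pv_tr2 t : PV (tr (sc2 t) ≈ t)%F
| pv_cat0 s : PV (cat2 s zero ≈ s)%F
| pv_cat1 s t : PV (cat2 s (sc1 t) ≈ sc1 (cat2 s t))%F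
| pv_cat2 s t : PV (cat2 s (sc2 t) ≈ sc2 (cat2 s t))%F
| pv_smash0 s : PV (smash s zero ≈ zero)%F
| pv_smash1 s t : PV (smash s (sc1 t) ≈ cat2 s (smash s t))%F
| pv_smash2 s t : PV (smash s (sc2 t) ≈ cat2 s (smash s t))%F
| pv_less0 s : PV (less s zero ≈ s)%F
| pv_less1 s t : PV (less s (sc1 t) ≈ tr (less s t))%F
| pv_less2 s t : PV (less s (sc2 t) ≈ tr (less s t))%F
| pv_proj n (i : 'I_n) v : PV (App (PvProj i) v ≈ v i)%F
| pv_comp n m (f : pv m) (g : 'I_m -> pv n) v :
    PV (App (PvComp f g) v ≈ App f (fun j => App (g j) v))%F
| pv_rec0 n (g : pv n) h1 h2 k y :
    PV (App (PvRec g h1 h2 k) (acons zero y)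
        ≈ cut (App g y) (App k (acons zero y)))%F
| pv_rec1 n (g : pv n) h1 h2 k x y :
    PV (App (PvRec g h1 h2 k) (acons (sc1 x) y)
        ≈ cut (App h1 (acons x (acons (App (PvRec g h1 h2 k) (acons x y)) y)))
              (App k (acons (sc1 x) y)))%F
| pv_rec2 n (g : pv n) h1 h2 k x y :
    PV (App (PvRec g h1 h2 k) (acons (sc2 x) y)
        ≈ cut (App h2 (acons x (acons (App (PvRec g h1 h2 k) (acons x y)) y)))
              (App k (acons (sc2 x) y)))%F
| pv_ind_rule A : qfree A ->
    prov PV [:: finst A zero] ->
    prov PV [:: Imp A (fsubst (scons (sc1 (Var 0)) (fun i => Var i.+1)) A)] ->
    prov PV [:: Imp A (fsubst (scons (sc2 (Var 0)) (fun i => Var i.+1)) A)] ->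
    PV A.

(** ** The order of the natural numbers in PV *)

(** λ x_0 ... x_{n-1}. t *)
Fixpoint plam (n : nat) (t : term pv) : pv n :=
  match t with
  | Var i =>
      (match i < n as b return (i < n) = b -> pv n with
       | true => fun h => PvProj (Ordinal h)
       | false => fun _ => PvComp PvZero [args]
       end) erefl
  | App m f v => PvComp f (fun j => plam n (v j))
  end.

(** sw(w, a, b, c) is a, b or c according to whether w is empty, ends in the
    digit 1, or ends in the digit 2. *)
Definition PvSwitch : pv 4 :=
  PvRec (plam 3 (Var 0)) (plam 5 (Var 3)) (plam 5 (Var 4))
    (plam 4 (cat2 (Var 1) (cat2 (Var 2) (Var 3)))).
Definition sw (w a b c : term pv) : term pv := App PvSwitch [args w; a; b; c].

(** If |x| >= |y|, compares the first |y| digits of x with y lexicographically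
    (0: equal, 1: smaller, 2: larger); 1 if |x| < |y|.  The arguments are in
    the order (y, x). *)
Definition PvCmp : pv 2 :=
  PvRec (plam 1 zero)
    (plam 3 (sw (less (sc1 (Var 0)) (Var 2))
               (sw (Var 1)
                  (sw (cut (Var 2) (sc1 (Var 0))) zero zero (num 2)) (Var 1) (Var 1))
               (num 1) (num 1)))
    (plam 3 (sw (less (sc2 (Var 0)) (Var 2))
               (sw (Var 1)
                  (sw (cut (Var 2) (sc2 (Var 0))) zero (num 1) zero) (Var 1) (Var 1))
               (num 1) (num 1)))
    (plam 2 (num 2)).

(** The characteristic function of x < y. *)
Definition PvLt : pv 2 :=
  plam 2 (sw (less (Var 0) (Var 1))
            (sw (App PvCmp [args Var 1; Var 0]) zero (num 1) zero) zero zero).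

Definition ltN (s t : term pv) : form pv := (App PvLt [args s; t] ≈ num 1)%F.

(** * PRA

    Primitive recursive function symbols, built over those of PV; the recursion
    variable comes first:
      f(0, y) = g(y),   f(x+1, y) = h(x, f(x, y), y). *)
Inductive pr : nat -> Type :=
| PrPV (n : nat) (f : pv n) : pr n
| PrS : pr 1
| PrProj (n : nat) (i : 'I_n) : pr n
| PrComp (n m : nat) (f : pr m) (g : 'I_m -> pr n) : pr n
| PrRec (n : nat) (g : pr n) (h : pr n.+2) : pr n.+1.

Definition tlift : term pv -> term pr := tmap PrPV.
Definition flift : form pv -> form pr := fmap PrPV.

Definition rnum (n : nat) : term pr := tlift (num n).
Definition rS (t : term pr) : term pr := App PrS [args t].
Definition rsc1 (t : term pr) : term pr := App (PrPV PvS1) [args t].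
Definition rsc2 (t : term pr) : term pr := App (PrPV PvS2) [args t].

Inductive PRA : form pr -> Prop :=
| pra_pv A : PV A -> PRA (flift A)
| pra_S_neq0 t : PRA (rS t ≉ rnum 0)%F
| pra_S_inj s t : PRA (rS s ≈ rS t ⟶ s ≈ t)%F
| pra_s1_0 : PRA (rsc1 (rnum 0) ≈ rS (rnum 0))%F
| pra_s1_S t : PRA (rsc1 (rS t) ≈ rS (rS (rsc1 t)))%F
| pra_s2 t : PRA (rsc2 t ≈ rS (rsc1 t))%F
| pra_proj n (i : 'I_n) v : PRA (App (PrProj i) v ≈ v i)%F
| pra_comp n m (f : pr m) (g : 'I_m -> pr n) v :
    PRA (App (PrComp f g) v ≈ App f (fun j => App (g j) v))%F
| pra_rec0 n (g : pr n) h y :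
    PRA (App (PrRec g h) (acons (rnum 0) y) ≈ App g y)%F
| pra_recS n (g : pr n) h x y :
    PRA (App (PrRec g h) (acons (rS x) y)
         ≈ App h (acons x (acons (App (PrRec g h) (acons x y)) y)))%F
| pra_ind A : qfree A ->
    PRA (finst A (rnum 0)
         ⟶ All (A ⟶ fsubst (scons (rS (Var 0)) (fun i => Var i.+1)) A)
         ⟶ All A)%F.

Definition rltN (s t : term pr) : form pr :=
  (App (PrPV PvLt) [args s; t] ≈ rnum 1)%F.

(** Coding of finite sequences by Gödel's function
    (c, d, i) ↦ c mod (1 + d(i+1)). *)
Definition PrZero (n : nat) : pr n := PrComp (PrPV PvZero) [args].
Definition PrAdd : pr 2 :=
  PrRec (PrProj (n := 1) ord0) (PrComp PrS [args PrProj (n := 3) (@Ordinal 3 1 erefl)]).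
Definition PrMul : pr 2 :=
  PrRec (PrZero 1)
    (PrComp PrAdd [args PrProj (@Ordinal 3 2 erefl); PrProj (@Ordinal 3 1 erefl)]).
Definition PrMod : pr 2 :=
  let r1 := PrComp PrS [args PrProj (@Ordinal 3 1 erefl)] in
  PrRec (PrZero 1)
    (PrComp (PrPV PvSwitch)
       [args PrComp (PrPV PvLt) [args r1; PrProj (@Ordinal 3 2 erefl)];
             PrZero 3; r1; r1]).
Definition entry (c d i : term pr) : term pr :=
  App PrMod [args c; rS (App PrMul [args d; rS i])].

(** * Ordinals

    [osup f] is the least ordinal strictly above all [f a]; ordinals are
    compared by [ole] and identified along [oeq]. *)
Inductive Ord : Type := osup (A : Type) (f : A -> Ord).

Fixpoint ole (x y : Ord) {struct x} : Prop :=
  match x, y with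
  | osup A f, osup B g => forall a, exists b, ole (f a) (g b)
  end.
Definition olt (x y : Ord) : Prop :=
  match y with osup B g => exists b, ole x (g b) end.
Definition oeq (x y : Ord) : Prop := ole x y /\ ole y x.

Definition ozero : Ord := @osup False (fun a => match a with end).
Fixpoint onat (n : nat) : Ord :=
  if n is m.+1 then osup (fun _ : unit => onat m) else ozero.
Definition oomega : Ord := osup onat.

Fixpoint oadd (x y : Ord) {struct y} : Ord :=
  match x, y with
  | osup A f, osup B g =>
      osup (fun c : A + B => match c with inl a => f a | inr b => oadd x (g b) end)
  end.

(** x·y is the least ordinal above all x·z + w with z < y and w < x. *)
Fixpoint omul (x y : Ord) {struct y} : Ord :=
  match x, y with
  | osup A f, osup B g => osup (fun c : B * A => oadd (omul x (g c.1)) (f c.2))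
  end.

(** ω^y is the least ordinal above 0 and all ω^z·n with z < y and n < ω. *)
Fixpoint oexp_omega (y : Ord) : Ord :=
  match y with
  | osup B g =>
      osup (fun c : option (B * nat) =>
              match c with
              | None => ozero
              | Some (b, n) => omul (oexp_omega (g b)) (onat n)
              end)
  end.

Definition ord_closed (a : Ord) : Prop :=
  [/\ forall b c, olt b a -> olt c a -> olt (oadd b c) a,
      forall b c, olt b a -> olt c a -> olt (omul b c) a
    & forall b, olt b a -> olt (oexp_omega b) a].

(** * Ptime representations of ordinals *)

(** The formulas and terms are in the variable x = [Var 0] or the variables
    x = [Var 0], y = [Var 1]; [on_sub] is x ∸ y and [on_div] is d(x, y). *)
Record ord_notation := OrdNotation {
  on_O : form pv;
  on_lt : form pv;
  on_add : term pv;
  on_mul : term pv;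
  on_sub : term pv;
  on_div : term pv;
  on_o : term pv;
  on_exp : pr 1;
  on_0 : nat;
  on_1 : nat;
  on_w : nat }.

Definition well_scoped (R : ord_notation) : Prop :=
  [/\ qfree (on_O R) /\ fscoped 1 (on_O R),
      qfree (on_lt R) /\ fscoped 2 (on_lt R),
      tscoped 2 (on_add R) /\ tscoped 2 (on_mul R),
      tscoped 2 (on_sub R) /\ tscoped 2 (on_div R)
    & tscoped 1 (on_o R)].

(** Membership and order in the standard model. *)
Definition inO (R : ord_notation) (b : nat) : Prop := std (on_O R) (fun _ => b).
Definition ltO (R : ord_notation) (b c : nat) : Prop :=
  std (on_lt R) (scons b (fun _ => c)).
Definition leO (R : ord_notation) (b c : nat) : Prop := ltO R b c \/ b = c.

Definition represents (R : ord_notation) (a : Ord) : Prop :=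
  exists e : nat -> Ord,
    [/\ forall b, inO R b -> olt (e b) a,
        forall b c, inO R b -> inO R c -> (ltO R b c <-> olt (e b) (e c))
      & forall x, olt x a -> exists2 b, inO R b & oeq (e b) x].

Definition Of (R : ord_notation) (t : term pv) : form pv := finst (on_O R) t.
Definition Lt (R : ord_notation) (s t : term pv) : form pv := fapp2 (on_lt R) s t.
Definition Le (R : ord_notation) (s t : term pv) : form pv := (Lt R s t ∨ s ≈ t)%F.

(** ∀β A(β) for a Greek variable β, and ∀γ≺t A(γ); both bind [Var 0] of A. *)
Definition AllO (R : ord_notation) (A : form pv) : form pv :=
  All (Of R (Var 0) ⟶ A)%F.
Definition AllLt (R : ord_notation) (t : term pv) (A : form pv) : form pv :=
  AllO R (Lt R (Var 0) (tshift t) ⟶ A)%F.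

(** PV ⊢ ∀β₀...∀β_{k-1} A, with the quantifiers left implicit. *)
Definition pvO (R : ord_notation) (k : nat) (A : form pv) : Prop :=
  proves PV (foldr (fun i B => Of R (Var i) ⟶ B)%F A (iota 0 k)).

Record pv_laws (R : ord_notation) : Prop := {
  law_irrefl : pvO R 1 (neg (Lt R (Var 0) (Var 0)));
  law_trans : pvO R 3
    (Lt R (Var 0) (Var 1) ⟶ Lt R (Var 1) (Var 2) ⟶ Lt R (Var 0) (Var 2));
  law_total : pvO R 2
    (Lt R (Var 0) (Var 1) ∨ Var 0 ≈ Var 1 ∨ Lt R (Var 1) (Var 0));
  law_zeroO : proves PV (Of R (num (on_0 R)));
  law_oneO : proves PV (Of R (num (on_1 R)));
  law_omegaO : proves PV (Of R (num (on_w R)));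
  law_min : pvO R 1 (Le R (num (on_0 R)) (Var 0));
  law_addO : pvO R 2 (Of R (tapp2 (on_add R) (Var 0) (Var 1)));
  law_mulO : pvO R 2 (Of R (tapp2 (on_mul R) (Var 0) (Var 1)));
  law_subO : pvO R 2 (Of R (tapp2 (on_sub R) (Var 0) (Var 1)));
  law_divO : pvO R 2
    (Var 1 ≉ num (on_0 R) ⟶ Of R (tapp2 (on_div R) (Var 0) (Var 1)));
  law_discrete : pvO R 2
    (Lt R (Var 1) (tapp2 (on_add R) (Var 0) (num (on_1 R)))
     ⟶ Lt R (Var 1) (Var 0) ∨ Var 1 ≈ Var 0);
  law_addA : pvO R 3
    (tapp2 (on_add R) (tapp2 (on_add R) (Var 0) (Var 1)) (Var 2)
     ≈ tapp2 (on_add R) (Var 0) (tapp2 (on_add R) (Var 1) (Var 2)));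
  law_mulA : pvO R 3
    (tapp2 (on_mul R) (tapp2 (on_mul R) (Var 0) (Var 1)) (Var 2)
     ≈ tapp2 (on_mul R) (Var 0) (tapp2 (on_mul R) (Var 1) (Var 2)));
  law_distr : pvO R 3
    (tapp2 (on_mul R) (Var 0) (tapp2 (on_add R) (Var 1) (Var 2))
     ≈ tapp2 (on_add R) (tapp2 (on_mul R) (Var 0) (Var 1))
                        (tapp2 (on_mul R) (Var 0) (Var 2)));
  law_addr0 : pvO R 1 (tapp2 (on_add R) (Var 0) (num (on_0 R)) ≈ Var 0);
  law_add0r : pvO R 1 (tapp2 (on_add R) (num (on_0 R)) (Var 0) ≈ Var 0);
  law_mulr1 : pvO R 1 (tapp2 (on_mul R) (Var 0) (num (on_1 R)) ≈ Var 0);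
  law_mul1r : pvO R 1 (tapp2 (on_mul R) (num (on_1 R)) (Var 0) ≈ Var 0);
  law_mulr0 : pvO R 1 (tapp2 (on_mul R) (Var 0) (num (on_0 R)) ≈ num (on_0 R));
  law_mul0r : pvO R 1 (tapp2 (on_mul R) (num (on_0 R)) (Var 0) ≈ num (on_0 R));
  law_addlt : pvO R 3
    (Lt R (Var 2) (Var 1)
     ⟶ Lt R (tapp2 (on_add R) (Var 0) (Var 2)) (tapp2 (on_add R) (Var 0) (Var 1)));
  law_mullt : pvO R 3
    (Lt R (Var 2) (Var 1) ⟶ Var 0 ≉ num (on_0 R)
     ⟶ Lt R (tapp2 (on_mul R) (Var 0) (Var 2)) (tapp2 (on_mul R) (Var 0) (Var 1)));
  law_addle : pvO R 3
    (Le R (Var 2) (Var 1)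
     ⟶ Le R (tapp2 (on_add R) (Var 2) (Var 0)) (tapp2 (on_add R) (Var 1) (Var 0)));
  law_mulle : pvO R 3
    (Le R (Var 2) (Var 1)
     ⟶ Le R (tapp2 (on_mul R) (Var 2) (Var 0)) (tapp2 (on_mul R) (Var 1) (Var 0)));
  law_sub_lt : pvO R 2
    (Lt R (Var 0) (Var 1) ⟶ tapp2 (on_sub R) (Var 0) (Var 1) ≈ num (on_0 R));
  law_sub_ge : pvO R 2
    (Le R (Var 1) (Var 0)
     ⟶ Var 0 ≈ tapp2 (on_add R) (Var 1) (tapp2 (on_sub R) (Var 0) (Var 1)));
  law_div_le : pvO R 2
    (Var 1 ≉ num (on_0 R)
     ⟶ Le R (tapp2 (on_mul R) (Var 1) (tapp2 (on_div R) (Var 0) (Var 1))) (Var 0));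
  law_div_rem : pvO R 2
    (Var 1 ≉ num (on_0 R)
     ⟶ Lt R (tapp2 (on_sub R) (Var 0)
               (tapp2 (on_mul R) (Var 1) (tapp2 (on_div R) (Var 0) (Var 1))))
            (Var 1));
  law_oO : proves PV (Of R (tapp1 (on_o R) (Var 0))
                      ∧ Lt R (tapp1 (on_o R) (Var 0)) (num (on_w R)));
  law_o_lt : proves PV
    (ltN (Var 0) (Var 1)
     ⟷ Lt R (tapp1 (on_o R) (Var 0)) (tapp1 (on_o R) (Var 1)));
  law_o_onto : pvO R 1
    (Lt R (Var 0) (num (on_w R)) ⟶ Ex (Var 1 ≈ tapp1 (on_o R) (Var 0)));
  law_o_0 : proves PV (tapp1 (on_o R) (num 0) ≈ num (on_0 R))%F;
  law_o_1 : proves PV (tapp1 (on_o R) (num 1) ≈ num (on_1 R))%F }.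

Definition rOf (R : ord_notation) (t : term pr) : form pr := finst (flift (on_O R)) t.
Definition rLt (R : ord_notation) (s t : term pr) : form pr :=
  fapp2 (flift (on_lt R)) s t.
Definition rLe (R : ord_notation) (s t : term pr) : form pr := (rLt R s t ∨ s ≈ t)%F.
Definition radd (R : ord_notation) (s t : term pr) : term pr :=
  tapp2 (tlift (on_add R)) s t.
Definition rmul (R : ord_notation) (s t : term pr) : term pr :=
  tapp2 (tlift (on_mul R)) s t.
Definition rexp (R : ord_notation) (t : term pr) : term pr := App (on_exp R) [args t].
Definition rAllO (R : ord_notation) (A : form pr) : form pr :=
  All (rOf R (Var 0) ⟶ A)%F.
Definition rAllLt (R : ord_notation) (t : term pr) (A : form pr) : form pr :=
  rAllO R (rLt R (Var 0) (tshift t) ⟶ A)%F.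

Definition praO (R : ord_notation) (k : nat) (A : form pr) : Prop :=
  proves PRA (foldr (fun i B => rOf R (Var i) ⟶ B)%F A (iota 0 k)).

Definition rlimit (R : ord_notation) (b : term pr) : form pr :=
  (b ≉ rnum (on_0 R)
   ∧ rAllLt R b (rLt R (radd R (Var 0) (rnum (on_1 R))) (tshift b)))%F.

(** b = ω^{e_0} + ... + ω^{e_{l-1}} with e_0 ⪰ ... ⪰ e_{l-1} in O, where (c, d)
    codes the sequence of exponents e_i and (p, q) that of the partial sums. *)
Definition rcnf (R : ord_notation) (b l c d p q : term pr) : form pr :=
  let x := Var 0 in
  let e i := entry (tshift c) (tshift d) i in
  let u i := entry (tshift p) (tshift q) i in
  (entry p q (rnum 0) ≈ rnum (on_0 R)
   ∧ entry p q l ≈ b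
   ∧ All (rltN x (tshift l) ⟶
            rOf R (e x)
            ∧ u (rS x) ≈ radd R (u x) (rexp R (e x))
            ∧ (rltN (rS x) (tshift l) ⟶ rLe R (e (rS x)) (e x))))%F.

Record pra_laws (R : ord_notation) : Prop := {
  law_expO : praO R 1 (rOf R (rexp R (Var 0)));
  law_exp0 : proves PRA (rexp R (rnum (on_0 R)) ≈ rnum (on_1 R))%F;
  law_exp1 : proves PRA (rexp R (rnum (on_1 R)) ≈ rnum (on_w R))%F;
  law_exp_mono : praO R 2
    (rLe R (Var 0) (Var 1) ⟶ rLe R (rexp R (Var 0)) (rexp R (Var 1)));
  law_expD : praO R 2
    (rexp R (radd R (Var 0) (Var 1)) ≈ rmul R (rexp R (Var 0)) (rexp R (Var 1)));
  law_exp_sup : praO R 1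
    (rlimit R (Var 0)
     ⟶ rAllLt R (Var 0) (rLe R (rexp R (Var 0)) (rexp R (Var 1)))
       ∧ rAllO R (rAllLt R (Var 1) (rLe R (rexp R (Var 0)) (Var 1))
                  ⟶ rLe R (rexp R (Var 1)) (Var 0)));
  law_cnf_ex : praO R 1
    (Ex (Ex (Ex (Ex (Ex
       (rcnf R (Var 5) (Var 4) (Var 3) (Var 2) (Var 1) (Var 0)))))));
  law_cnf_uniq : praO R 1
    (rcnf R (Var 0) (Var 1) (Var 2) (Var 3) (Var 4) (Var 5)
     ⟶ rcnf R (Var 0) (Var 6) (Var 7) (Var 8) (Var 9) (Var 10)
     ⟶ Var 1 ≈ Var 6
       ∧ All (rltN (Var 0) (Var 2)
              ⟶ entry (Var 3) (Var 4) (Var 0) ≈ entry (Var 8) (Var 9) (Var 0))) }.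

Definition ptime_representation (a : Ord) (R : ord_notation) : Prop :=
  [/\ ole oomega a /\ ord_closed a, well_scoped R, represents R a,
      pv_laws R & pra_laws R].

(** * Transfinite induction and flows *)

(** ∀δ (∀γ≺δ A(γ) → A(δ)) → A(θ), where A = A(γ, ...) with γ = [Var 0]; in
    the inner quantifier the parameters of A are shifted past δ. *)
Definition ti_instance (R : ord_notation) (A : form pv) (theta : nat) : form pv :=
  (AllO R (AllLt R (Var 0) (fsubst (scons (Var 0) (fun i => Var i.+2)) A) ⟶ A)
   ⟶ finst A (num theta))%F.

Inductive TI (R : ord_notation) : form pv -> Prop :=
| ti_pv A : PV A -> TI R A
| ti_ti A theta : forall1 A -> inO R theta -> TI R (ti_instance R A theta).

(** The pair (H(γ, x), β) is a flow from A(x) to B(x), for x = x_0, ..., x_{n-1};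
    in H the variable γ is [Var 0] and x_i is [Var i.+1]. *)
Definition is_flow (R : ord_notation) (n : nat) (A B H : form pv) (beta : nat) : Prop :=
  [/\ forall1 H /\ fscoped n.+1 H,
      inO R beta /\ leO R (on_1 R) beta,
      proves PV (A ⟷ finst H (num (on_0 R)))%F,
      proves PV
        (AllO R (Le R (num (on_1 R)) (Var 0) ∧ Le R (Var 0) (num beta)
                 ⟶ AllLt R (Var 0) (fsubst (scons (Var 0) (fun i => Var i.+2)) H)
                 ⟶ H))%F
    & proves PV (finst H (num beta) ⟷ B)%F].

Definition flows (R : ord_notation) (n : nat) (G D : seq (form pv)) : Prop :=
  exists H beta, is_flow R n (bigAnd G) (bigOr D) H beta.

(* Main.v *)
Require Import Defs.
From mathcomp Require Import all_boot.
From Stdlib Require Import Classical ClassicalEpsilon FunctionalExtensionality.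
From Stdlib Require Import PropExtensionality ProofIrrelevance.
Set Implicit Arguments.
Unset Strict Implicit.
Unset Printing Implicit Defensive.

(** Both directions are semantic. The relation "there is a flow from ⋀Γ to ⋁Δ"
    on ∀₁-sequents is closed under cut (flows are composed by ordinal addition),
    under the rules of the ∀₁-fragment of logic, and under a transfinite induction
    rule (flows are iterated by ordinal multiplication, and positions are read off
    by ordinal division). A Henkin construction for an arbitrary entailment relation
    with these closure properties turns a sequent without flow into a model of
    TI(∀₁, ≺) that refutes it: the induction rule provides, for each false A(θ), a
    witness δ with A(δ) false and A(γ) true for all γ ≺ δ. The same
    construction applied to derivability gives the completeness theorem, so that
    provability in PV can be checked in models. Conversely, a flow (H, β) is turned
    into a derivation by transfinite induction on "γ ⪯ β → H(γ)" up to β. *)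

(** * Substitution *)

(** The obstacle is that an induction instance is not a ∀₁-formula: the negation of its hypothesis
    asserts the existence of some δ. An induction on derivations would first have to eliminate cuts
    down to ∀₁-formulas. The model construction avoids this: it decides only formulas of the class,
    treats induction as a rule all of whose formulas are ∀₁, and recovers the full axiom by
    evaluation in the model. For this it matters that the axioms of PV are quantifier-free, so that
    they belong to the class, and that every element of the model is the value of a term, so that
    parameters can be replaced by substitutions. On the side of flows, the decisive point is that
    the length β is a fixed number: it does not vary with the parameters, so a flow can be put under
    a universal quantifier, and one block length serves every δ in the induction rule. *)

Section Substitution.
Variable S : nat -> Type.
Implicit Types (s r : nat -> term S) (t u : term S) (A B : form S).

Lemma tsubst_comp s r t :
  tsubst s (tsubst r t) = tsubst (fun i => tsubst s (r i)) t.
Proof.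
elim: t => //= n f v IH; congr App; apply: functional_extensionality => j.
exact: IH.
Qed.

Lemma tsubst_id t : tsubst Var t = t.
Proof.
elim: t => //= n f v IH; congr App; apply: functional_extensionality => j.
exact: IH.
Qed.

Lemma up_tshift s t : tsubst (up s) (tshift t) = tshift (tsubst s t).
Proof. by rewrite /tshift !tsubst_comp. Qed.

Lemma up_comp s r : (fun i => tsubst (up s) (up r i)) = up (fun i => tsubst s (r i)).
Proof. by apply: functional_extensionality => -[|i] //=; apply: up_tshift. Qed.

Lemma up_Var : up (@Var S) = Var.
Proof. by apply: functional_extensionality => -[|i]. Qed.

Lemma fsubst_comp s r A :
  fsubst s (fsubst r A) = fsubst (fun i => tsubst s (r i)) A.
Proof.
elim: A s r => //= [t u|t u|A IHA B IHB|A IHA B IHB|A IH|A IH] s r;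
  by rewrite ?tsubst_comp ?IHA ?IHB ?IH ?up_comp.
Qed.

Lemma fsubst_id A : fsubst Var A = A.
Proof.
by elim: A => //= [t u|t u|A -> B ->|A -> B ->|A IH|A IH];
  rewrite ?tsubst_id ?up_Var ?IH.
Qed.

Lemma scons_tshift t s u : tsubst (scons t s) (tshift u) = tsubst s u.
Proof. by rewrite /tshift tsubst_comp. Qed.

Lemma fsubst_up_fshift s A : fsubst (up s) (fshift A) = fshift (fsubst s A).
Proof. by rewrite /fshift !fsubst_comp. Qed.

Lemma finst_up A s t : finst (fsubst (up s) A) t = fsubst (scons t s) A.
Proof.
rewrite /finst fsubst_comp; congr fsubst; apply: functional_extensionality.
by case=> //= i; rewrite scons_tshift tsubst_id.
Qed.

Lemma fsubst_finst A s t : fsubst s (finst A t) = finst (fsubst (up s) A) (tsubst s t).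
Proof.
rewrite finst_up /finst fsubst_comp; congr fsubst; apply: functional_extensionality.
by case.
Qed.

Lemma neg_fsubst s A : neg (fsubst s A) = fsubst s (neg A).
Proof. by elim: A s => //= [A IHA B IHB|A IHA B IHB|A IH|A IH] s; rewrite ?IHA ?IHB ?IH. Qed.

Lemma tscoped_le n m t : n <= m -> tscoped n t -> tscoped m t.
Proof.
move=> le; elim: t => /= [i lti|k f v IH h j]; first exact: leq_trans le.
exact: IH.
Qed.

Lemma fscoped_le n m A : n <= m -> fscoped n A -> fscoped m A.
Proof.
elim: A n m => //= [t u|t u|A IHA B IHB|A IHA B IHB|A IH|A IH] n m le.
- by case; split; apply: tscoped_le le _.
- by case; split; apply: tscoped_le le _.
- by case=> ??; split; [apply: IHA le _ | apply: IHB le _].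
- by case=> ??; split; [apply: IHA le _ | apply: IHB le _].
- exact: IH.
- exact: IH.
Qed.

Lemma ex_tscoped t : exists n, tscoped n t.
Proof.
elim: t => [i|k f v IH]; first by exists i.+1 => /=.
have [N hN] := choice _ IH.
exists (\max_i N i) => j /=; apply: tscoped_le (hN j).
exact: (leq_bigmax j).
Qed.

Lemma ex_fscoped A : exists n, fscoped n A.
Proof.
elim: A => [||t u|t u|A [n hn] B [m hm]|A [n hn] B [m hm]|A [n hn]|A [n hn]].
1,2: by exists 0.
1,2: have [n hn] := ex_tscoped t; have [m hm] := ex_tscoped u; exists (maxn n m);
     by split; [apply: tscoped_le hn|apply: tscoped_le hm]; rewrite ?leq_maxl ?leq_maxr.
1,2: exists (maxn n m);
     by split; [apply: fscoped_le hn|apply: fscoped_le hm]; rewrite ?leq_maxl ?leq_maxr.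
1,2: by exists n; apply: fscoped_le hn.
Qed.

(** This supplies the eigenvariable of a witnessing task: [Var n] occurs free in no member of
    [G]. *)
Lemma ex_fscoped_all (G : seq (form S)) :
  exists n, forall A, List.In A G -> fscoped n A.
Proof.
elim: G => [|A G [n hn]]; first by exists 0.
have [m hm] := ex_fscoped A; exists (maxn n m) => B /= [<-|/hn h].
  by apply: fscoped_le hm; rewrite leq_maxr.
by apply: fscoped_le h; rewrite leq_maxl.
Qed.

Lemma tsubst_scoped n s r t :
  tscoped n t -> (forall i, i < n -> s i = r i) -> tsubst s t = tsubst r t.
Proof.
move=> + h; elim: t => /= [i /h //|k f v IH hv]; congr App.
by apply: functional_extensionality => j; apply: IH.
Qed.

Lemma fsubst_scoped n s r A :
  fscoped n A -> (forall i, i < n -> s i = r i) -> fsubst s A = fsubst r A.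
Proof.
elim: A n s r => //= [t u|t u|A IHA B IHB|A IHA B IHB|A IH|A IH] n s r.
- by case=> h1 h2 h; rewrite (tsubst_scoped h1 h) (tsubst_scoped h2 h).
- by case=> h1 h2 h; rewrite (tsubst_scoped h1 h) (tsubst_scoped h2 h).
- by case=> h1 h2 h; rewrite (IHA _ _ _ h1 h) (IHB _ _ _ h2 h).
- by case=> h1 h2 h; rewrite (IHA _ _ _ h1 h) (IHB _ _ _ h2 h).
- by move=> hA h; rewrite (IH n.+1 (up s) (up r)) //; case=> //= i /h ->.
- by move=> hA h; rewrite (IH n.+1 (up s) (up r)) //; case=> //= i /h ->.
Qed.

Lemma tscoped_tsubst n m s t :
  tscoped n t -> (forall i, i < n -> tscoped m (s i)) -> tscoped m (tsubst s t).
Proof.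
by move=> + h; elim: t => /= [i /h //|k f v IH hv] j; apply: IH.
Qed.

Lemma fscoped_fsubst n m s A :
  fscoped n A -> (forall i, i < n -> tscoped m (s i)) -> fscoped m (fsubst s A).
Proof.
have hup k l r : (forall i, i < k -> tscoped l (r i)) ->
    forall i, i < k.+1 -> tscoped l.+1 (up r i).
  by move=> h [|i] //= /h hi; apply: tscoped_tsubst hi _.
elim: A n m s => //= [t u|t u|A IHA B IHB|A IHA B IHB|A IH|A IH] n m s.
- by case=> h1 h2 h; split; [apply: tscoped_tsubst h1 h|apply: tscoped_tsubst h2 h].
- by case=> h1 h2 h; split; [apply: tscoped_tsubst h1 h|apply: tscoped_tsubst h2 h].
- by case=> h1 h2 h; split; [apply: IHA h1 h|apply: IHB h2 h].
- by case=> h1 h2 h; split; [apply: IHA h1 h|apply: IHB h2 h].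
- by move=> hA /hup; apply: IH.
- by move=> hA /hup; apply: IH.
Qed.

Lemma qfree_neg A : qfree A -> qfree (neg A).
Proof. by elim=> //= *; constructor. Qed.

Lemma qfree_forall1 A : qfree A -> forall1 A.
Proof. by elim=> //= *; constructor. Qed.

Lemma qfree_fsubst s A : qfree A -> qfree (fsubst s A).
Proof. by elim=> //= *; constructor. Qed.

Lemma forall1_fsubst s A : forall1 A -> forall1 (fsubst s A).
Proof. by move=> h; elim: h s => //= *; constructor; auto. Qed.

End Substitution.

(** * Structures *)

Record structure (S : nat -> Type) := Structure {
  dom :> Type;
  fn : forall n, S n -> ('I_n -> dom) -> dom }.

Section Semantics.
Variables (S : nat -> Type) (M : structure S).
Implicit Types (e : nat -> M) (t u : term S) (A B : form S).

Fixpoint value e t : M :=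
  match t with
  | Var i => e i
  | App n f v => fn f (fun j => value e (v j))
  end.

Fixpoint sat e A : Prop :=
  match A with
  | Top => True
  | Bot => False
  | Eq s t => value e s = value e t
  | Neq s t => value e s <> value e t
  | And A B => sat e A /\ sat e B
  | Or A B => sat e A \/ sat e B
  | All A => forall x, sat (scons x e) A
  | Ex A => exists x, sat (scons x e) A
  end.

Lemma sat_And e A B : sat e (And A B) = (sat e A /\ sat e B).
Proof. by []. Qed.

Lemma sat_Or e A B : sat e (Or A B) = (sat e A \/ sat e B).
Proof. by []. Qed.

Lemma value_tsubst e s t : value e (tsubst s t) = value (fun i => value e (s i)) t.
Proof.
elim: t => //= n f v IH; congr fn; apply: functional_extensionality => j.
exact: IH.
Qed.

Lemma value_up e s x :
  (fun i => value (scons x e) (up s i)) = scons x (fun i => value e (s i)).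
Proof.
by apply: functional_extensionality => -[|i] //=; rewrite /tshift value_tsubst.
Qed.

Lemma sat_fsubst e s A : sat e (fsubst s A) = sat (fun i => value e (s i)) A.
Proof.
elim: A e s => //= [t u|t u|A IHA B IHB|A IHA B IHB|A IH|A IH] e s;
  rewrite ?value_tsubst ?IHA ?IHB //.
  by apply: propositional_extensionality; split=> h x;
    move: (h x); rewrite IH value_up.
by apply: propositional_extensionality; split=> -[x h]; exists x;
  move: h; rewrite IH value_up.
Qed.

Lemma value_cons e t : (fun i => value e (scons t Var i)) = scons (value e t) e.
Proof. by apply: functional_extensionality => -[]. Qed.

Lemma sat_finst e A t : sat e (finst A t) = sat (scons (value e t) e) A.
Proof. by rewrite /finst sat_fsubst value_cons. Qed.

Lemma sat_fshift e x A : sat (scons x e) (fshift A) = sat e A.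
Proof. by rewrite /fshift sat_fsubst. Qed.

Lemma value_tshift e x t : value (scons x e) (tshift t) = value e t.
Proof. by rewrite /tshift value_tsubst. Qed.

Lemma sat_neg e A : sat e (neg A) = (~ sat e A).
Proof.
apply: propositional_extensionality.
elim: A e => [||s t|s t|A IHA B IHB|A IHA B IHB|A IH|A IH] e /=; try tauto.
- by rewrite IHA IHB; tauto.
- by rewrite IHA IHB; tauto.
- split=> [[x /IH h] /(_ x) //|h]; apply: NNPP => hn; apply: h => x.
  by apply: NNPP => hx; apply: hn; exists x; apply/IH.
- split=> [h [x hx]|h x]; first by have /IH := h x.
  by apply/IH => hx; apply: h; exists x.
Qed.

Lemma sat_Imp e A B : sat e (Imp A B) = (sat e A -> sat e B).
Proof.
rewrite /= sat_neg; apply: propositional_extensionality.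
by case: (classic (sat e A)); tauto.
Qed.

Lemma sat_Iff e A B : sat e (Iff A B) = (sat e A <-> sat e B).
Proof.
change ((sat e (Imp A B) /\ sat e (Imp B A)) = (sat e A <-> sat e B)).
rewrite !sat_Imp.
by apply: propositional_extensionality; tauto.
Qed.

Lemma value_scoped n e e' t :
  tscoped n t -> (forall i, i < n -> e i = e' i) -> value e t = value e' t.
Proof.
move=> + h; elim: t => /= [i /h //|k f v IH hv]; congr fn.
by apply: functional_extensionality => j; apply: IH.
Qed.

Lemma sat_scoped n e e' A :
  fscoped n A -> (forall i, i < n -> e i = e' i) -> sat e A = sat e' A.
Proof.
have hs k (f g : nat -> M) x : (forall i, i < k -> f i = g i) ->
    forall i, i < k.+1 -> scons x f i = scons x g i.
  by move=> h [|i] //= /h.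
elim: A n e e' => //= [t u|t u|A IHA B IHB|A IHA B IHB|A IH|A IH] n e e'.
- by case=> h1 h2 h; rewrite (value_scoped h1 h) (value_scoped h2 h).
- by case=> h1 h2 h; rewrite (value_scoped h1 h) (value_scoped h2 h).
- by case=> h1 h2 h; rewrite (IHA _ _ _ h1 h) (IHB _ _ _ h2 h).
- by case=> h1 h2 h; rewrite (IHA _ _ _ h1 h) (IHB _ _ _ h2 h).
- move=> hA h; apply: propositional_extensionality.
  by split=> hx x; have := hx x; rewrite (IH _ _ _ hA (hs _ _ _ x h)).
- move=> hA h; apply: propositional_extensionality.
  by split=> -[x hx]; exists x; move: hx; rewrite (IH _ _ _ hA (hs _ _ _ x h)).
Qed.

Lemma sat_bigAnd e G : sat e (bigAnd G) <-> (forall A, List.In A G -> sat e A).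
Proof.
elim: G => [|A G IH] //=; rewrite IH; split; last by move=> h; split; auto.
by case=> h1 h2 B [<-|/h2].
Qed.

Lemma sat_bigOr e G : sat e (bigOr G) <-> (exists2 A, List.In A G & sat e A).
Proof.
elim: G => [|A G IH] /=; first by split=> // -[].
rewrite IH; split; first by case=> [h|[B ? ?]]; [exists A|exists B]; auto.
by case=> B [<-|hB] h; [left|right; exists B].
Qed.

Definition models (T : form S -> Prop) := forall A, T A -> forall e, sat e A.

End Semantics.

(** Transparent: the recursion of [PV_std] goes through the derivations nested in
    [pv_ind_rule], and its guard check has to unfold this proof. *)
Lemma prov_sound (S : nat -> Type) (T : form S -> Prop) (M : structure S)
    (hT : models M T) G :
  prov T G -> forall e : nat -> M, exists2 A, List.In A G & sat e A.
Proof.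
elim=> {G} [A hA|A||t|A s t|A B G _ IHA _ IHB|A B G _ IH|A G _ IH|A t G _ IH
           |A G _ IHA _ IHB|G D _ IH sub] e.
- by exists A; [left|apply: hT].
- case: (classic (sat e A)) => h; first by exists A => //; right; left.
  by exists (neg A); [left|rewrite sat_neg].
- by exists Top; [left|].
- by exists (Eq t t); [left|].
- case: (classic (value e s = value e t)) => [eq|ne]; last by exists (Neq s t); [left|].
  case: (classic (sat e (finst A t))) => h; first by exists (finst A t) => //=; auto.
  by exists (neg (finst A s)); [right; left|rewrite sat_neg; move: h; rewrite !sat_finst eq].
- have [B1 [<-|i1] s1] := IHA e; last by exists B1 => //; right.
  have [B2 [<-|i2] s2] := IHB e; last by exists B2 => //; right.
  by exists (And A B); [left|].
- have [B1 [<-|[<-|i1]] s1] := IH e; last by exists B1 => //; right.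
  + by exists (Or A B); [left|left].
  + by exists (Or A B); [left|right].
- case: (classic (exists2 B, List.In B G & sat e B)) => [[B ? ?]|hn].
    by exists B => //; right.
  exists (All A); first by left.
  move=> x; have [B [<- //|/List.in_map_iff [B' [<- iB]]]] := IH (scons x e).
  by rewrite sat_fshift => h; case: hn; exists B'.
- have [B [<-|iB] sB] := IH e; last by exists B => //; right.
  by exists (Ex A); [left|exists (value e t); rewrite -sat_finst].
- have [B1 [<-|i1] s1] := IHA e; last by exists B1.
  by have [B2 [<-|i2] s2] := IHB e; [move: s2; rewrite sat_neg|exists B2].
- by have [B /sub ? ?] := IH e; exists B.
Defined.

Lemma proves_sound (S : nat -> Type) (T : form S -> Prop) (M : structure S) A :
  models M T -> proves T A -> forall e : nat -> M, sat e A.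
Proof. by move=> hT /(prov_sound hT) h e; have [B [<-|[]]] := h e. Qed.

(** * Henkin models of entailment relations *)

Definition within (X : Type) (P : X -> Prop) (G : seq X) : Prop :=
  forall A, List.In A G -> P A.

Lemma within_cons X (P : X -> Prop) A G : P A -> within P G -> within P (A :: G).
Proof. by move=> hA hG B [<-|/hG]. Qed.

Lemma within_nil X (P : X -> Prop) : within P [::].
Proof. by []. Qed.

Lemma within_cat X (P : X -> Prop) G D :
  within P G -> within P D -> within P (G ++ D).
Proof. by move=> hG hD B /List.in_app_iff [/hG|/hD]. Qed.

Lemma within_map X Y (P : Y -> Prop) (f : X -> Y) G :
  within (fun x => P (f x)) G -> within P (map f G).
Proof. by move=> h B /List.in_map_iff [A [<- /h]]. Qed.

Local Hint Resolve within_cons within_nil within_cat : core.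

(** The rules without eigenvariable, each reduced to an axiom from which cut and weakening recover
    the rule. The eigenvariable rules for quantifiers are left to [wrule]. *)
Inductive initial (S : nat -> Type) : seq (form S) -> seq (form S) -> Prop :=
| in_id A : initial [:: A] [:: A]
| in_top : initial [::] [:: Top]
| in_bot : initial [:: Bot] [::]
| in_andl A B : initial [:: And A B] [:: A]
| in_andr A B : initial [:: And A B] [:: B]
| in_and A B : initial [:: A; B] [:: And A B]
| in_or A B : initial [:: Or A B] [:: A; B]
| in_orl A B : initial [:: A] [:: Or A B]
| in_orr A B : initial [:: B] [:: Or A B]
| in_all A t : initial [:: All A] [:: finst A t]
| in_ex A t : initial [:: finst A t] [:: Ex A]
| in_eq_neq s t : initial [:: Eq s t; Neq s t] [::]
| in_eq_or_neq s t : initial [::] [:: Eq s t; Neq s t]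
| in_refl t : initial [::] [:: Eq t t]
| in_leibniz A s t : initial [:: Eq s t; finst A s] [:: finst A t].

(** A witnessing rule passes from [L ++ G] ⇒ [R ++ D] to [Tr ++ G] ⇒ [Fr ++ D],
    where [Var 0] is an eigenvariable of the premise. *)
Record wrule (S : nat -> Type) := Wrule {
  wr_tr : seq (form S);
  wr_fr : seq (form S);
  wr_l : seq (form S);
  wr_r : seq (form S) }.

Definition all_wrule (S : nat -> Type) (A : form S) :=
  Wrule [::] [:: All A] [::] [:: A].
Definition ex_wrule (S : nat -> Type) (A : form S) :=
  Wrule [:: Ex A] [::] [:: A] [::].

(** The class [C] is closed under subformulas and substitution but need not be closed under
    connectives, so it can be the ∀₁-formulas as well as all formulas. [W] has to contain the
    logical eigenvariable rules for members of [C] and may contain more. *)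
Record entailment (S : nat -> Type) (C : form S -> Prop)
    (E : seq (form S) -> seq (form S) -> Prop) (W : wrule S -> Prop) : Prop := {
  class_eq : forall s t, C (Eq s t);
  class_neq : forall s t, C (Neq s t);
  class_top : C Top;
  class_bot : C Bot;
  class_and : forall A B, C (And A B) -> C A /\ C B;
  class_or : forall A B, C (Or A B) -> C A /\ C B;
  class_all : forall A, C (All A) -> C A;
  class_ex : forall A, C (Ex A) -> C A;
  class_subst : forall s A, C A -> C (fsubst s A);
  class_wrule : forall w, W w ->
    [/\ within C (wr_tr w), within C (wr_fr w), within C (wr_l w) & within C (wr_r w)];
  wrule_all : forall A, C (All A) -> W (all_wrule A);
  wrule_ex : forall A, C (Ex A) -> W (ex_wrule A);
  ent_weak : forall G D G' D', within C G' -> within C D' ->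
    List.incl G G' -> List.incl D D' -> E G D -> E G' D';
  ent_cut : forall A G D, C A -> within C G -> within C D ->
    E G (A :: D) -> E (A :: G) D -> E G D;
  ent_subst : forall s G D, within C G -> within C D ->
    E G D -> E (map (fsubst s) G) (map (fsubst s) D);
  ent_initial : forall G D, within C G -> within C D -> initial G D -> E G D;
  ent_wrule : forall w G D, W w -> within C G -> within C D ->
    E (wr_l w ++ map (@fshift S) G) (wr_r w ++ map (@fshift S) D) ->
    E (wr_tr w ++ G) (wr_fr w ++ D) }.

(** * Saturation of an underivable sequent *)

Section Saturation.
Variables (S : nat -> Type) (code : form S -> nat) (code_inj : injective code).
Variables (C : form S -> Prop) (E : seq (form S) -> seq (form S) -> Prop).
Variables (W : wrule S -> Prop) (ent : entailment C E W).

Definition ready (p : seq (form S) * seq (form S)) : Prop :=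
  [/\ within C p.1, within C p.2 & ~ E p.1 p.2].

Definition extends (p q : seq (form S) * seq (form S)) : Prop :=
  List.incl p.1 q.1 /\ List.incl p.2 q.2.

Lemma extends_refl p : extends p p.
Proof. by split=> A. Qed.

Lemma extends_trans p q r : extends p q -> extends q r -> extends p r.
Proof. by case=> h1 h2 [h3 h4]; split=> A; auto. Qed.

Definition finstvar (c : nat) (A : form S) : form S := finst A (Var c).

(** A witnessing task is skipped when its principal formulas would make the stage derivable. By
    weakening this persists at later stages, so one visit to each task is enough. *)
Definition task_done (i : form S + wrule S)
    (p q : seq (form S) * seq (form S)) : Prop :=
  match i with
  | inl A => C A -> List.In A q.1 \/ List.In A q.2
  | inr w => W w -> E (wr_tr w ++ p.1) (wr_fr w ++ p.2) \/
      exists c, List.incl (map (finstvar c) (wr_l w)) q.1 /\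
                List.incl (map (finstvar c) (wr_r w)) q.2
  end.

Definition task_code (i : form S + wrule S) : nat :=
  pickle (match i with
          | inl A => inl (code A)
          | inr w => inr (map code (wr_tr w), map code (wr_fr w),
                          map code (wr_l w), map code (wr_r w))
          end : nat + (seq nat * seq nat * seq nat * seq nat)).

Lemma task_code_inj : injective task_code.
Proof.
move=> i j /(pcan_inj pickleK); have minj := inj_map code_inj.
case: i j => [A|[a b c d]] [B|[a' b' c' d']] //= []; first by move=> /code_inj ->.
by move=> /minj -> /minj -> /minj -> /minj ->.
Qed.

(** Sending the fresh variable [c] to [Var 0] and shifting all others up turns instances at [c] back
    into the premise of a witnessing rule, and the side formulas into their shifted form. *)
Lemma fshift_rename c G : within (fscoped c) G ->
  map (fsubst (fun i => if i == c then Var 0 else Var i.+1)) G = map (@fshift S) G.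
Proof.
elim: G => //= A G IH h; rewrite IH; last by move=> B hB; apply: h; right.
congr cons; apply: (@fsubst_scoped S c); first by apply: h; left.
by move=> i; case: eqP => // ->; rewrite ltnn.
Qed.

Lemma finstvar_rename c G : within (fscoped c) G ->
  map (fsubst (fun i => if i == c then Var 0 else Var i.+1)) (map (finstvar c) G) = G.
Proof.
move=> h; rewrite -map_comp -[RHS]map_id.
elim: G h => //= A G IH h; rewrite IH; last by move=> B hB; apply: h; right.
congr cons; rewrite /finstvar /finst fsubst_comp -[RHS]fsubst_id.
apply: (@fsubst_scoped S c); first by apply: h; left.
by case=> [|i] /= lti; rewrite ?eqxx //; case: eqP => // eq; move: lti; rewrite -eq ltnNge leqnSn.
Qed.

Lemma do_task i p : ready p ->
  exists q, [/\ ready q, extends p q & task_done i p q].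
Proof.
case: p => G D [/= hG hD con].
case: i => [A|w].
  case: (classic (C A)) => hA; last by exists (G, D); split; [|exact: extends_refl|].
  case: (classic (E (A :: G) D)) => hE; last first.
    exists (A :: G, D); split; [by split=> /=; auto| |by left; left].
    by split=> B //=; right.
  exists (G, A :: D); split; last by right; left.
    by split=> /=; auto => hE'; apply: con; apply: (ent_cut ent (A := A)).
  by split=> B //=; right.
case: (classic (W w)) => hw; last by exists (G, D); split; [|exact: extends_refl|].
case: (classic (E (wr_tr w ++ G) (wr_fr w ++ D))) => hE.
  by exists (G, D); split; [|exact: extends_refl|left].
have [hTr hFr hL hR] := class_wrule ent hw.
have [c hc] := ex_fscoped_all
  ((wr_tr w ++ G) ++ (wr_fr w ++ D) ++ wr_l w ++ wr_r w).
have cl X : within C X -> within C (map (finstvar c) X).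
  by move=> hX; apply: within_map => A /hX; apply: (class_subst ent).
(* The principal formulas are added along with their instances at [c]. If this stage were derivable,
   renaming [c] and applying the rule would derive the principal formulas over the old stage; the
   second copy produced by the rule is absorbed by contraction. *)
exists (map (finstvar c) (wr_l w) ++ (wr_tr w ++ G),
        map (finstvar c) (wr_r w) ++ (wr_fr w ++ D)); split.
- split=> /=; [by auto|by auto|] => hE'; apply: hE.
  have sub1 : List.incl (wr_tr w ++ (wr_tr w ++ G)) (wr_tr w ++ G).
    by move=> A; rewrite !List.in_app_iff; tauto.
  have sub2 : List.incl (wr_fr w ++ (wr_fr w ++ D)) (wr_fr w ++ D).
    by move=> A; rewrite !List.in_app_iff; tauto.
  apply: (ent_weak ent _ _ sub1 sub2); [by auto|by auto|].
  apply: (ent_wrule ent hw); [by auto|by auto|].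
  have := ent_subst ent (fun i => if i == c then Var 0 else Var i.+1) _ _ hE'.
  rewrite !(map_cat _ (map _ _)) !finstvar_rename ?fshift_rename; try by
    move=> A hA; apply: hc; rewrite !List.in_app_iff; move: hA; rewrite ?List.in_app_iff; tauto.
  by apply; auto.
- by split=> A /= hA; rewrite !List.in_app_iff; tauto.
- by move=> _; right; exists c; split=> A /= hA; rewrite !List.in_app_iff; tauto.
Qed.

Lemma do_tasks k (p : {p | ready p}) : exists q : {q | ready q},
  extends (sval p) (sval q) /\
  (forall i, task_code i = k -> task_done i (sval p) (sval q)).
Proof.
case: p => p hp /=.
case: (classic (exists i, task_code i = k)) => [[i hi]|hn]; last first.
  by exists (exist _ p hp); split=> [|i hi]; [exact: extends_refl|case: hn; exists i].
have [q [hq ext td]] := do_task i hp.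
exists (exist _ q hq); split=> //= j hj.
by have -> : j = i by apply: task_code_inj; rewrite hi hj.
Qed.

Lemma saturation G D : within C G -> within C D -> ~ E G D ->
  exists T F : form S -> Prop,
    [/\ within T G /\ within F D, forall A, T A \/ F A -> C A,
        forall A, C A -> T A \/ F A,
        forall G' D', within T G' -> within F D' -> ~ E G' D'
      & forall w, W w -> within T (wr_tr w) -> within F (wr_fr w) ->
        exists c, within T (map (finstvar c) (wr_l w)) /\
                  within F (map (finstvar c) (wr_r w))].
Proof.
move=> hG hD con.
have r0 : ready (G, D) by split.
have [next hnext] := choice _ (fun kp => do_tasks kp.1 kp.2).
pose P := fix P k : {p | ready p} :=
  if k is j.+1 then next (j, P j) else exist _ (G, D) r0.
have ext k j : k <= j -> extends (sval (P k)) (sval (P j)).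
  move=> /subnK <-; elim: (j - k) => [|m IH]; first exact: extends_refl.
  by apply: extends_trans IH _; have [] := hnext (m + k, P (m + k)).
pose T A := exists k, List.In A (sval (P k)).1.
pose F A := exists k, List.In A (sval (P k)).2.
have finT X : within T X -> exists k, List.incl X (sval (P k)).1.
  elim: X => [|A X IH] h; first by exists 0.
  have [k1 h1] : T A by apply: h; left.
  have [k2 h2] : exists k, List.incl X (sval (P k)).1 by apply: IH => B hB; apply: h; right.
  exists (maxn k1 k2) => B [<-|/h2]; last by apply: (ext _ _ _).1; rewrite leq_maxr.
  by apply: (ext _ _ _).1 h1; rewrite leq_maxl.
have finF X : within F X -> exists k, List.incl X (sval (P k)).2.
  elim: X => [|A X IH] h; first by exists 0.
  have [k1 h1] : F A by apply: h; left.
  have [k2 h2] : exists k, List.incl X (sval (P k)).2 by apply: IH => B hB; apply: h; right.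
  exists (maxn k1 k2) => B [<-|/h2]; last by apply: (ext _ _ _).2; rewrite leq_maxr.
  by apply: (ext _ _ _).2 h1; rewrite leq_maxl.
(* Finitely many formulas of the limit all lie in a single stage, and no stage is derivable. *)
have cons X Y : within T X -> within F Y -> ~ E X Y.
  move=> /finT [k1 h1] /finF [k2 h2] hE.
  have [c1 c2] := svalP (P (maxn k1 k2)); apply.
  apply: (ent_weak ent c1 c2 _ _ hE) => A.
    by move=> /h1; apply: (ext _ _ _).1; rewrite leq_maxl.
  by move=> /h2; apply: (ext _ _ _).2; rewrite leq_maxr.
have TC A : T A -> C A by case=> k; have [h _ _] := svalP (P k); apply: h.
have FC A : F A -> C A by case=> k; have [_ h _] := svalP (P k); apply: h.
exists T, F; split=> //.
- by split=> A hA; exists 0.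
- by move=> A [/TC|/FC].
- move=> A hA; set k := task_code (inl A).
  have [_ /(_ (inl A) erefl hA)] := hnext (k, P k).
  by case=> h; [left|right]; exists k.+1.
- move=> w hw hT hF; set k := task_code (inr w).
  have [_ /(_ (inr w) erefl hw)] := hnext (k, P k).
  have [hTr hFr _ _] := class_wrule ent hw.
  case=> [hE|[c [h1 h2]]]; last first.
    by exists c; split=> A hA; exists k.+1; [apply: h1|apply: h2].
  (* The task cannot have been skipped: the principal formulas and stage [k] lie in [T] and [F],
     between which nothing is derivable. *)
  case: (@cons (wr_tr w ++ (sval (P k)).1) (wr_fr w ++ (sval (P k)).2) _ _ hE).
    by apply: within_cat => // A hA; exists k.
  by apply: within_cat => // A hA; exists k.
Qed.

End Saturation.

(** * Term model of a saturated pair *)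

Section TermModel.
Variables (S : nat -> Type) (C : form S -> Prop).
Variables (E : seq (form S) -> seq (form S) -> Prop) (W : wrule S -> Prop).
Variable ent : entailment C E W.
Variables T F : form S -> Prop.
Hypotheses (TF_class : forall A, T A \/ F A -> C A)
  (TF_total : forall A, C A -> T A \/ F A)
  (TF_con : forall G D, within T G -> within F D -> ~ E G D)
  (TF_wit : forall w, W w -> within T (wr_tr w) -> within F (wr_fr w) ->
     exists c, within T (map (finstvar c) (wr_l w)) /\
               within F (map (finstvar c) (wr_r w))).

Lemma sat_initial G D : within T G -> within C D -> initial G D ->
  exists2 A, List.In A D & T A.
Proof.
move=> hT hC hi; apply: NNPP => hn.
have hF : within F D.
  move=> A hA; case: (TF_total (hC _ hA)) => // hTA.
  by case: hn; exists A.
apply: (TF_con hT hF); apply: (ent_initial ent) hi => // A hA.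
by apply: TF_class; left; apply: hT.
Qed.

Lemma sat_initial1 G A : within T G -> C A -> initial G [:: A] -> T A.
Proof.
by move=> hT hA /(sat_initial hT) [|B [<-|[]]] //; auto.
Qed.

Lemma sat_initial11 A B : T A -> C B -> initial [:: A] [:: B] -> T B.
Proof. by move=> hA; apply: sat_initial1; auto. Qed.

Lemma notT A : C A -> F A <-> ~ T A.
Proof.
move=> hA; split=> [hF hT|]; last by case: (TF_total hA).
apply: (@TF_con [:: A] [:: A]); auto.
by apply: (ent_initial ent); auto; constructor.
Qed.

Local Notation eqv s t := (T (Eq s t)).

Lemma eqv_refl t : eqv t t.
Proof.
by apply: (@sat_initial1 [::]); [|apply: (class_eq ent)|constructor].
Qed.

Lemma eqv_leibniz A s t : C A -> eqv s t -> T (finst A s) -> T (finst A t).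
Proof.
move=> hA h1 h2; apply: (@sat_initial1 [:: Eq s t; finst A s]); auto.
  exact: (class_subst ent _ hA).
exact: in_leibniz.
Qed.

Lemma eqv_sym s t : eqv s t -> eqv t s.
Proof.
move=> h; have := @eqv_leibniz (Eq (Var 0) (tshift s)) s t (class_eq ent _ _) h.
rewrite /finst /= !scons_tshift !tsubst_id; apply; exact: eqv_refl.
Qed.

Lemma eqv_trans s t u : eqv s t -> eqv t u -> eqv s u.
Proof.
move=> h1 h2; have := @eqv_leibniz (Eq (tshift s) (Var 0)) t u (class_eq ent _ _) h2.
by rewrite /finst /= !scons_tshift !tsubst_id; apply.
Qed.

(** [in_leibniz] exchanges a single term, so the arguments are replaced one at a time: [mix k] has
    the first [k] of them replaced, and [hole] marks the next one. *)
Lemma eqv_App n (f : S n) (v w : 'I_n -> term S) :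
  (forall j, eqv (v j) (w j)) -> eqv (App f v) (App f w).
Proof.
move=> h; pose mix k (j : 'I_n) := if j < k then w j else v j.
have step k : eqv (App f v) (App f (mix k)).
  elim: k => [|k IH].
    have -> : mix 0 = v by apply: functional_extensionality.
    exact: eqv_refl.
  case: (ltnP k n) => hk; last first.
    have -> : mix k.+1 = mix k; last exact: IH.
    apply: functional_extensionality => j; rewrite /mix.
    by rewrite !(leq_trans (ltn_ord j)) // leqW.
  pose o := Ordinal hk.
  pose hole (j : 'I_n) := if j == o then Var 0 else tshift (mix k j).
  have := @eqv_leibniz (Eq (tshift (App f v)) (App f hole)) _ _ (class_eq ent _ _) (h o).
  have inst t : finst (Eq (tshift (App f v)) (App f hole)) t =
      Eq (App f v) (App f (fun j => if j == o then t else mix k j)).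
    rewrite /finst /= -/tshift; congr Eq; congr App; apply: functional_extensionality => j.
      by rewrite -/(tshift _) scons_tshift tsubst_id.
    by rewrite /hole; case: eqP => //= _; rewrite scons_tshift tsubst_id.
  rewrite !inst.
  have -> : (fun j => if j == o then v o else mix k j) = mix k.
    apply: functional_extensionality => j; case: eqP => // ->.
    by rewrite /mix ltnn.
  have -> : (fun j => if j == o then w o else mix k j) = mix k.+1.
    apply: functional_extensionality => j; rewrite /mix; case: eqP => [-> /=|ne].
      by rewrite leqnn.
    rewrite [in RHS]ltnS [in RHS]leq_eqVlt; case: eqP => [eq|_ //].
    by case: ne; apply: val_inj.
  by apply.
have -> : w = mix n by apply: functional_extensionality => j; rewrite /mix ltn_ord.
exact: step.
Qed.

(** [sat] reads equality as identity of elements, so terms identified by [T] have to be merged. A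
    chosen representative takes the place of a quotient; by extensionality [epsilon] picks the same
    one for equivalent terms. *)
Definition repr (t : term S) : term S := epsilon (inhabits (Var 0)) (fun u => eqv t u).

Lemma repr_eqv t : eqv t (repr t).
Proof. by apply: (epsilon_spec _ (fun u => eqv t u)); exists t; apply: eqv_refl. Qed.

Lemma repr_ext s t : eqv s t -> repr s = repr t.
Proof.
move=> h; congr epsilon; apply: functional_extensionality => u.
apply: propositional_extensionality; split; last exact: eqv_trans.
exact: eqv_trans (eqv_sym h).
Qed.

Lemma repr_repr t : repr (repr t) = repr t.
Proof. by apply: repr_ext; apply: eqv_sym; apply: repr_eqv. Qed.

Definition cls (t : term S) : {t | repr t = t} := exist _ (repr t) (repr_repr t).

Lemma cls_eq s t : cls s = cls t <-> eqv s t.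
Proof.
split=> [[eq]|/repr_ext eq].
  by apply: eqv_trans (repr_eqv s) _; rewrite eq; apply: eqv_sym; apply: repr_eqv.
by apply: eq_sig_hprop => [*|//]; apply: proof_irrelevance.
Qed.

Definition term_model : structure S :=
  @Structure S {t | repr t = t} (fun n f v => cls (App f (fun j => sval (v j)))).

Definition term_env (i : nat) : term_model := cls (Var i).

Lemma value_term_env t : value term_env t = cls t.
Proof.
elim: t => //= n f v IH; apply/cls_eq/eqv_App => j.
by rewrite IH /=; apply: eqv_sym; apply: repr_eqv.
Qed.

Lemma term_model_onto (d : term_model) : exists t, d = value term_env t.
Proof.
case: d => t ht; exists t; rewrite value_term_env.
by apply: eq_sig_hprop => [*|/=]; [apply: proof_irrelevance|rewrite ht].
Qed.

Lemma sat_cons_term e A t :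
  sat (scons (value e t) e) A = sat (M := term_model) e (finst A t).
Proof. by rewrite sat_finst. Qed.

(** The substitution is kept general in the induction on [A], because the instances of a quantified
    formula are not among its subformulas. *)
Lemma truth_subst A s : C (fsubst s A) -> sat term_env (fsubst s A) <-> T (fsubst s A).
Proof.
elim: A s => [||t u|t u|A IHA B IHB|A IHA B IHB|A IH|A IH] s /= hC.
- by split=> // _; apply: (@sat_initial1 [::]) => //; constructor.
- split=> // h; have [||A []] := @sat_initial [:: Bot] [::] _ _ (in_bot _); auto.
- by rewrite !value_term_env cls_eq.
- rewrite !value_term_env cls_eq; split=> [hn|h1 h2].
    have [| |A [<-|[<-|[]]]] // := @sat_initial [::] _ _ _ (in_eq_or_neq (tsubst s t) (tsubst s u)).
    by apply: within_cons; auto; apply: (class_eq ent _ _).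
  by have [||A []] := @sat_initial [:: _; _] [::] _ _ (in_eq_neq (tsubst s t) (tsubst s u)); auto.
- have [hA hB] := class_and ent hC; rewrite IHA // IHB //; split=> [[h1 h2]|h].
    by apply: (@sat_initial1 [:: _; _]) => //; last exact: in_and; auto.
  by split; apply: sat_initial11 h _ _ => //; constructor.
- have [hA hB] := class_or ent hC; rewrite IHA // IHB //; split.
    by case=> h; apply: sat_initial11 h _ _ => //; constructor.
  move=> h; have [||X [<-|[<-|[]]]] :=
    @sat_initial _ _ _ _ (in_or (fsubst s A) (fsubst s B)); auto.
- have hA := class_all ent hC.
  have hA' t : C (fsubst (scons t s) A) by rewrite -finst_up; apply: (class_subst ent _ hA).
  split=> [h|h x]; last first.
    have [t ->] := term_model_onto x.
    rewrite sat_cons_term finst_up IH // -finst_up.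
    by apply: sat_initial11 h _ (in_all _ _); rewrite finst_up.
  (* By its witnessing rule, a universal formula outside [T] has a false instance at some
     variable. *)
  apply: NNPP => hn; have [//||c [_ hc]] := TF_wit (wrule_all ent hC).
    by apply: within_cons => //; apply/notT.
  have := hc _ (or_introl erefl); rewrite /finstvar finst_up notT //; apply.
  by apply/IH => //; rewrite -finst_up -sat_cons_term; apply: h.
- have hA := class_ex ent hC.
  have hA' t : C (fsubst (scons t s) A) by rewrite -finst_up; apply: (class_subst ent _ hA).
  split=> [[x]|h].
    have [t ->] := term_model_onto x; rewrite sat_cons_term finst_up IH // -finst_up => h.
    by apply: sat_initial11 h _ (in_ex _ t).
  have [|//|c [hc _]] := TF_wit (wrule_ex ent hC); first by apply: within_cons.
  have := hc _ (or_introl erefl); rewrite /finstvar finst_up -IH // -finst_up -sat_cons_term.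
  by exists (value term_env (Var c)).
Qed.

Lemma truth A : C A -> sat term_env A <-> T A.
Proof. by have := @truth_subst A Var; rewrite fsubst_id. Qed.

End TermModel.

(** Beyond refuting the sequent, the conclusion records that elements are named by terms and that
    the rules of [W] are reflected at [e]; an extra rule of [W] thereby becomes a property of the
    model. *)
Theorem henkin_model (S : nat -> Type) (code : form S -> nat) (code_inj : injective code)
    C E W (ent : @entailment S C E W) G D :
  within C G -> within C D -> ~ E G D ->
  exists (M : structure S) (e : nat -> M),
    [/\ within (sat e) G /\ within (fun A => ~ sat e A) D,
        forall A, C A -> E [::] [:: A] -> sat e A,
        forall d, exists t, d = value e t
      & forall w, W w -> within (sat e) (wr_tr w) ->
        within (fun A => ~ sat e A) (wr_fr w) ->
        exists d, within (sat (scons d e)) (wr_l w) /\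
                  within (fun A => ~ sat (scons d e) A) (wr_r w)].
Proof.
move=> hG hD con.
have [T [F [[hT hF] TFC tot cons wit]]] := saturation code_inj ent hG hD con.
have tr A := truth ent TFC tot cons wit (A := A).
have nT A := notT ent tot cons (A := A).
have TC A : T A -> C A by move=> h; apply: (TFC); left.
have FC A : F A -> C A by move=> h; apply: (TFC); right.
exists (term_model ent TFC tot cons), (term_env ent TFC tot cons); split.
- split=> A hA; first by apply/tr; auto.
  by move=> /tr h; case: (nT A _).1; auto.
- move=> A hA hE; apply/tr => //; apply: NNPP => /nT h.
  by apply: (@cons [::] [:: A]); auto.
- exact: term_model_onto.
- move=> w hw h1 h2; have [hTr hFr hL hR] := class_wrule ent hw.
  have [||c [h3 h4]] := wit w hw.
  + by move=> A hA; apply/tr; auto.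
  + by move=> A hA; apply/nT; [auto|move=> /tr h; apply: (h2 _ hA); auto].
  exists (value (term_env ent TFC tot cons) (Var c)).
  have cl A : C A -> C (finst A (Var c)) by apply: (class_subst ent).
  split=> A hA; rewrite -sat_finst.
    by apply/tr; [auto|apply: h3; apply: (List.in_map (finstvar c))].
  move=> /tr h; have /nT : F (finst A (Var c)) by apply: h4; apply: (List.in_map (finstvar c)).
  by apply; auto.
Qed.

(** * Completeness of the sequent calculus *)

Section Completeness.
Variables (S : nat -> Type) (T : form S -> Prop).

Lemma prov_all_inst A t : prov T [:: All A] -> prov T [:: finst A t].
Proof.
move=> h; apply: (@pr_cut S T (All A)).
  by apply: (pr_weak h) => X /=; tauto.
by apply: (@pr_ex S T (neg A) t); rewrite /finst -neg_fsubst; apply: pr_id.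
Qed.

(** [T] is not assumed closed under substitution: an axiom is substituted into by closing it
    universally and instantiating, as in [prov_ax_subst]. *)
Fixpoint alls (n : nat) (A : form S) : form S :=
  if n is m.+1 then alls m (All A) else A.

Lemma prov_alls n A : prov T [:: A] -> prov T [:: alls n A].
Proof. by elim: n A => //= n IH A h; apply: IH; apply: pr_all. Qed.

Lemma prov_alls_inst n A s : prov T [:: alls n A] ->
  prov T [:: fsubst (fun i => if i < n then s i else Var (i - n)) A].
Proof.
elim: n A s => [|n IH] A s /=.
  have -> : (fun i => Var (i - 0)) = @Var S.
    by apply: functional_extensionality => i; rewrite subn0.
  by rewrite fsubst_id.
move=> /(IH _ (fun i => s i.+1)) /= /(prov_all_inst (s 0)).
rewrite finst_up; congr (prov _ [:: fsubst _ _]).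
by apply: functional_extensionality => -[|i].
Qed.

Lemma prov_ax_subst A s : T A -> prov T [:: fsubst s A].
Proof.
move=> hA; have [n hn] := ex_fscoped A.
have := prov_alls_inst s (prov_alls n (pr_ax hA)).
by rewrite (fsubst_scoped hn (r := s)) // => i ->.
Qed.

Lemma prov_subst G s : prov T G -> prov T (map (fsubst s) G).
Proof.
move=> h; elim: h s => {G} [A hA|A||t|A t u|A B G _ IHA _ IHB|A B G _ IH|A G _ IH
  |A t G _ IH|A G _ IHA _ IHB|G D _ IH sub] s /=.
- exact: prov_ax_subst.
- by rewrite -neg_fsubst; apply: pr_id.
- exact: pr_top.
- exact: pr_refl.
- by rewrite -neg_fsubst !fsubst_finst; apply: pr_leibniz.
- by apply: pr_and; [apply: IHA|apply: IHB].
- by apply: pr_or; apply: IH.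
- apply: pr_all; have := IH (up s); rewrite /= -!map_comp.
  congr (prov _ (_ :: _)); apply: eq_map => B /=; exact: fsubst_up_fshift.
- by apply: (pr_ex (t := tsubst s t)); rewrite -fsubst_finst; apply: IH.
- apply: (@pr_cut S T (fsubst s A)); [exact: IHA|rewrite neg_fsubst; exact: IHB].
- apply: (pr_weak (IH s)) => B /List.in_map_iff [A [<- /sub hA]].
  exact: (List.in_map (fsubst s)).
Qed.

Definition derives (G D : seq (form S)) : Prop := prov T (map (@neg S) G ++ D).

Lemma derives_initial G D : initial G D -> derives G D.
Proof.
have idl A X : List.In (neg A) X -> List.In A X -> prov T X.
  by move=> h1 h2; apply: (pr_weak (pr_id T A)) => B [<-|[<-|[]]].
case=> {G D} [A||| A B|A B|A B|A B|A B|A B|A t|A t|s t|s t|t|A s t]; rewrite /derives /=.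
- exact: pr_id.
- exact: pr_top.
- exact: pr_top.
- by apply: pr_or; apply: (idl A) => /=; auto.
- by apply: pr_or; apply: (idl B) => /=; auto.
- apply: (@pr_weak S T [:: And A B; neg A; neg B]) => [|X /=]; last by tauto.
  by apply: pr_and; [apply: (idl A)|apply: (idl B)] => /=; auto.
- by apply: pr_and; [apply: (idl A)|apply: (idl B)] => /=; auto.
- apply: (@pr_weak S T [:: Or A B; neg A]) => [|X /=]; last by tauto.
  by apply: pr_or; apply: (idl A) => /=; auto.
- apply: (@pr_weak S T [:: Or A B; neg B]) => [|X /=]; last by tauto.
  by apply: pr_or; apply: (idl B) => /=; auto.
- by apply: (pr_ex (t := t)); rewrite /finst -neg_fsubst; apply: pr_id.
- apply: (@pr_weak S T [:: Ex A; neg (finst A t)]) => [|X /=]; last by tauto.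
  by apply: (pr_ex (t := t)); apply: (idl (finst A t)) => /=; auto.
- exact: (pr_id T (Eq s t)).
- exact: (pr_id T (Neq s t)).
- exact: pr_refl.
- exact: pr_leibniz.
Qed.

Inductive logical_wrule : wrule S -> Prop :=
| lw_all A : logical_wrule (all_wrule A)
| lw_ex A : logical_wrule (ex_wrule A).

Lemma map_neg_fshift G :
  map (@neg S) (map (@fshift S) G) = map (@fshift S) (map (@neg S) G).
Proof. by rewrite -!map_comp; apply: eq_map => A /=; rewrite neg_fsubst. Qed.

Lemma derives_entailment : entailment (fun _ => True) derives logical_wrule.
Proof.
split=> //; try by constructor.
- move=> G D G' D' _ _ sG sD; rewrite /derives => h; apply: (pr_weak h) => A.
  rewrite !List.in_app_iff => -[/List.in_map_iff [B [<- /sG hB]]|/sD]; last by right.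
  by left; apply: List.in_map.
- move=> A G D _ _ _ h1 h2; apply: (@pr_cut S T A) => //.
  by apply: (pr_weak h1) => B; rewrite /= !List.in_app_iff /=; tauto.
- move=> s G D _ _ /(prov_subst s); rewrite /derives map_cat -!map_comp.
  by congr (prov _ (_ ++ _)); apply: eq_map => A /=; rewrite neg_fsubst.
- by move=> G D _ _; apply: derives_initial.
- move=> w G D [] A _ _; rewrite /derives /= ?map_neg_fshift => h.
    apply: (@pr_weak S T (All A :: (map (@neg S) G ++ D))).
      apply: pr_all; apply: (pr_weak h) => B.
      by rewrite /= map_cat !List.in_app_iff /=; tauto.
    by move=> B; rewrite /= !List.in_app_iff /=; tauto.
  by apply: pr_all; rewrite map_cat.
Qed.

Theorem completeness (code : form S -> nat) A : injective code ->
  (forall M : structure S, models M T -> forall e : nat -> M, sat e A) -> proves T A.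
Proof.
move=> code_inj valid; apply: NNPP => np.
have [|||M [e [[_ hA] hE onto _]]] :=
  henkin_model (G := [::]) (D := [:: A]) code_inj derives_entailment; try by [].
apply: (hA A); first by left.
(* Axioms must hold under every environment [e']. As all elements are named, [e'] is [e] after a
   substitution, and substituted axioms are provable. *)
apply: valid => B hB e'; have [s hs] := choice _ (fun i => onto (e' i)).
have -> : e' = fun i => value e (s i) by apply: functional_extensionality.
by rewrite -sat_fsubst; apply: hE => //; apply: prov_ax_subst.
Qed.

End Completeness.

(** * Countability of the language of PV *)

(** Hidden arities are stored as leaves, so that equality of trees identifies the indices of the
    dependent types before the subterms are compared. *)
Fixpoint pv_tree (n : nat) (f : pv n) : GenTree.tree nat :=
  match f with
  | PvZero => GenTree.Node 0 [::]
  | PvS1 => GenTree.Node 1 [::]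
  | PvS2 => GenTree.Node 2 [::]
  | PvTr => GenTree.Node 3 [::]
  | PvCat => GenTree.Node 4 [::]
  | PvSmash => GenTree.Node 5 [::]
  | PvLess => GenTree.Node 6 [::]
  | PvProj n i => GenTree.Node 7 [:: GenTree.Leaf n; GenTree.Leaf (i : nat)]
  | PvComp n m f g => GenTree.Node 8
      [:: GenTree.Leaf n, GenTree.Leaf m, pv_tree f
        & map (fun j => pv_tree (g j)) (enum 'I_m)]
  | PvRec n g h1 h2 k => GenTree.Node 9
      [:: GenTree.Leaf n; pv_tree g; pv_tree h1; pv_tree h2; pv_tree k]
  end.

Lemma existT_nat_inj {P : nat -> Type} {n} {x y : P n} : existT P n x = existT P n y -> x = y.
Proof. exact: (Eqdep_dec.inj_pair2_eq_dec _ PeanoNat.Nat.eq_dec). Qed.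

Lemma pv_tree_inj n (f : pv n) m (g : pv m) :
  pv_tree f = pv_tree g -> existT pv n f = existT pv m g.
Proof.
elim: f m g => {n} [|||||||n i|n m f IHf g IHg|n g IHg h1 IH1 h2 IH2 k IHk] m'
  [|||||||n' i'|n' k' f' g'|n' g' h1' h2' k'] //=.
- by move=> [e]; move: i'; rewrite -e => i' /ord_inj ->.
- move=> [en em]; move: f' g'; rewrite -en -em => f' g' /IHf /existT_nat_inj <-.
  move=> /eq_in_map eqg; have -> // : g = g'; apply: functional_extensionality => j.
  by apply: existT_nat_inj; apply: IHg; apply: eqg; rewrite mem_enum.
- move=> [en]; move: g' h1' h2' k'; rewrite -en => g' h1' h2' k'.
  by move=> /IHg /existT_nat_inj <- /IH1 /existT_nat_inj <- /IH2 /existT_nat_inj <-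
    /IHk /existT_nat_inj <-.
Qed.

Fixpoint term_tree (t : term pv) : GenTree.tree nat :=
  match t with
  | Var i => GenTree.Leaf i
  | App n f v => GenTree.Node 0
      [:: GenTree.Leaf n, pv_tree f & map (fun j => term_tree (v j)) (enum 'I_n)]
  end.

Lemma term_tree_inj : injective term_tree.
Proof.
elim=> [i|n f v IH] [i'|n' f' v'] //=; first by case=> ->.
move=> [en]; move: f' v'; rewrite -en => f' v' /pv_tree_inj /existT_nat_inj <-.
move=> /eq_in_map eqv; congr App; apply: functional_extensionality => j.
by apply: IH; apply: eqv; rewrite mem_enum.
Qed.

Fixpoint form_tree (A : form pv) : GenTree.tree nat :=
  match A with
  | Top => GenTree.Node 0 [::]
  | Bot => GenTree.Node 1 [::]
  | Eq s t => GenTree.Node 2 [:: term_tree s; term_tree t]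
  | Neq s t => GenTree.Node 3 [:: term_tree s; term_tree t]
  | And A B => GenTree.Node 4 [:: form_tree A; form_tree B]
  | Or A B => GenTree.Node 5 [:: form_tree A; form_tree B]
  | All A => GenTree.Node 6 [:: form_tree A]
  | Ex A => GenTree.Node 7 [:: form_tree A]
  end.

Lemma form_tree_inj : injective form_tree.
Proof.
elim=> [||s t|s t|A IHA B IHB|A IHA B IHB|A IH|A IH]
       [||s' t'|s' t'|A' B'|A' B'|A'|A'] //=.
- by move=> [/term_tree_inj -> /term_tree_inj ->].
- by move=> [/term_tree_inj -> /term_tree_inj ->].
- by move=> [/IHA -> /IHB ->].
- by move=> [/IHA -> /IHB ->].
- by move=> [/IH ->].
- by move=> [/IH ->].
Qed.

Definition form_code (A : form pv) : nat := pickle (form_tree A).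

Lemma form_code_inj : injective form_code.
Proof. by move=> A B /(pcan_inj pickleK) /form_tree_inj. Qed.

(** * Models of PV *)

Lemma half_le n : n./2 <= n.
Proof. by rewrite leq_half_double -addnn leqW // leq_addr. Qed.

Lemma dyadic_ind (P : nat -> Prop) :
  P 0 -> (forall d x, P x -> P (dsucc d x)) -> forall x, P x.
Proof.
move=> P0 PS; elim/ltn_ind => -[//|y IH].
have <- : dsucc (odd y) y./2 = y.+1.
  by rewrite -[in RHS](odd_double_half y) /dsucc; case: (odd y).
by apply: PS; apply: IH; rewrite ltnS half_le.
Qed.

Lemma dsucc_half d x : exists2 y, dsucc d x = y.+1 & odd y = d /\ y./2 = x.
Proof.
case: d; [exists x.*2.+1|exists x.*2] => //=; rewrite ?odd_double ?doubleK //.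
by rewrite uphalf_double.
Qed.

Section DyadicRec.
Variables (X : Type) (b : X) (s : bool -> nat -> X -> X).

Lemma dyadic_rec_fuelE k x : x <= k -> dyadic_rec_fuel k b s x = dyadic_rec b s x.
Proof.
rewrite /dyadic_rec; elim/ltn_ind: x k => -[|y] IH [|k] //= le.
have lt : y./2 < y.+1 by rewrite ltnS half_le.
rewrite IH //; last by apply: leq_trans (half_le y) _.
by rewrite (IH _ lt y) // half_le.
Qed.

Lemma dyadic_recS d x : dyadic_rec b s (dsucc d x) = s d x (dyadic_rec b s x).
Proof.
have [y -> [<- <-]] := dsucc_half d x.
by rewrite {1}/dyadic_rec /= dyadic_rec_fuelE // half_le.
Qed.

End DyadicRec.

Lemma dtr_dsucc d x : dtr (dsucc d x) = x.
Proof. by have [y -> [_ <-]] := dsucc_half d x. Qed.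

Lemma dsucc_inj d x d' x' : dsucc d x = dsucc d' x' -> d = d' /\ x = x'.
Proof.
have [y -> [<- <-]] := dsucc_half d x; have [y' -> [<- <-]] := dsucc_half d' x'.
by move=> [->].
Qed.

Lemma dcatS x d y : dcat x (dsucc d y) = dsucc d (dcat x y).
Proof. exact: dyadic_recS. Qed.
Lemma dsmashS x d y : dsmash x (dsucc d y) = dcat x (dsmash x y).
Proof. exact: dyadic_recS. Qed.
Lemma dlessS x d y : dless x (dsucc d y) = dtr (dless x y).
Proof. exact: dyadic_recS. Qed.

Lemma anil_eq T (v w : 'I_0 -> T) : v = w.
Proof. by apply: functional_extensionality => -[]. Qed.

Lemma map_acons T U (g : T -> U) n a (v : 'I_n -> T) :
  (fun j => g (acons a v j)) = acons (g a) (fun j => g (v j)).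
Proof. by apply: functional_extensionality => -[[|m] h]. Qed.

Lemma acons_eta T n (v : 'I_n.+1 -> T) : v = acons (v ord0) (fun j => v (lift ord0 j)).
Proof.
apply: functional_extensionality => -[[|m] h] /=; congr v; exact: val_inj.
Qed.

Lemma value_acons S (M : structure S) (e : nat -> M) n (f : S n.+1) a v :
  value e (App f (acons a v)) = fn f (acons (value e a) (fun j => value e (v j))).
Proof. by rewrite -map_acons. Qed.

Definition std_model : structure pv := @Structure pv nat pv_std.

Lemma stdE A e : std A e = sat (M := std_model) e A.
Proof.
have hv t f : teval pv_std f t = value (M := std_model) f t.
  elim: t => //= n g v IH; congr pv_std; apply: functional_extensionality => j.
  exact: IH.
rewrite /std; elim: A e => //= [t u|t u|A IHA B IHB|A IHA B IHB|A IH|A IH] e;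
  rewrite ?hv ?IHA ?IHB //; apply: propositional_extensionality.
  by split=> h x; have := h x; rewrite IH.
by split=> -[x h]; exists x; move: h; rewrite IH.
Qed.

Lemma std_rec n (g : pv n) h1 h2 k x y :
  pv_std (PvRec g h1 h2 k) (acons x y) =
  dyadic_rec (dcut (pv_std g y) (pv_std k (acons 0 y)))
    (fun d x r => dcut (pv_std (if d then h2 else h1) (acons x (acons r y)))
                       (pv_std k (acons (dsucc d x) y))) x.
Proof.
have e : (fun j => acons x y (lift ord0 j)) = y.
  by apply: functional_extensionality => -[m h]; congr y; apply: val_inj.
by rewrite /= e.
Qed.

Lemma std_recS n (g : pv n) h1 h2 k d x y :
  pv_std (PvRec g h1 h2 k) (acons (dsucc d x) y) =
  dcut (pv_std (if d then h2 else h1) (acons x (acons (pv_std (PvRec g h1 h2 k) (acons x y)) y)))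
       (pv_std k (acons (dsucc d x) y)).
Proof. by rewrite !std_rec dyadic_recS. Qed.

Lemma scons_eta X (e : nat -> X) : e = scons (e 0) (fun i => e i.+1).
Proof. by apply: functional_extensionality => -[]. Qed.

Lemma PV_std : models std_model PV.
Proof.
rewrite /models; fix IH 2 => A hA.
case: hA => {A} [t|t|s t||t|t|s|s t|s t|s|s t|s t|s|s t|s t|n i v|n m f g v
  |n g h1 h2 k y|n g h1 h2 k x y|n g h1 h2 k x y|A hq p0 p1 p2] e.
- by [].
- by [].
- by move=> /(@dsucc_inj false _ true) [].
- by [].
- exact: (dtr_dsucc false).
- exact: (dtr_dsucc true).
- by [].
- exact: (dcatS _ false).
- exact: (dcatS _ true).
- by [].
- exact: (dsmashS _ false).
- exact: (dsmashS _ true).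
- by [].
- exact: (dlessS _ false).
- exact: (dlessS _ true).
- by [].
- by [].
- change (value (M := std_model) e (App (PvRec g h1 h2 k) (acons zero y)) =
    dcut (value (M := std_model) e (App g y)) (value (M := std_model) e (App k (acons zero y)))).
  by rewrite !value_acons -[LHS]/(pv_std _ _) std_rec.
- change (value (M := std_model) e (App (PvRec g h1 h2 k) (acons (sc1 x) y)) =
    dcut (value (M := std_model) e (App h1 (acons x (acons (App (PvRec g h1 h2 k) (acons x y)) y))))
         (value (M := std_model) e (App k (acons (sc1 x) y)))).
  by rewrite !value_acons map_acons value_acons -[LHS]/(pv_std _ _) (std_recS _ _ _ _ false).
- change (value (M := std_model) e (App (PvRec g h1 h2 k) (acons (sc2 x) y)) =
    dcut (value (M := std_model) e (App h2 (acons x (acons (App (PvRec g h1 h2 k) (acons x y)) y))))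
         (value (M := std_model) e (App k (acons (sc2 x) y)))).
  by rewrite !value_acons map_acons value_acons -[LHS]/(pv_std _ _) (std_recS _ _ _ _ true).
- have q0 := prov_sound IH p0; have q1 := prov_sound IH p1; have q2 := prov_sound IH p2.
  (* The three premises hold in the standard model, and induction on notation is sound there for the
     value of [Var 0]. *)
  rewrite (scons_eta e); elim/dyadic_ind: (e 0) => [|d x hx].
    have [B [<-|[]]] := q0 (fun i => e i.+1); by rewrite sat_finst.
  case: d.
    have [B [<-|[]]] := q2 (scons x (fun i => e i.+1)); rewrite sat_Imp sat_fsubst => /(_ hx).
    by congr sat; apply: functional_extensionality => -[].
  have [B [<-|[]]] := q1 (scons x (fun i => e i.+1)); rewrite sat_Imp sat_fsubst => /(_ hx).
  by congr sat; apply: functional_extensionality => -[].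
Qed.

Lemma args1_eta T (v : 'I_1 -> T) : v = [args v ord0].
Proof. by rewrite {1}(acons_eta v); congr acons; apply: anil_eq. Qed.

Lemma args2_eta T (v : 'I_2 -> T) : v = [args v ord0; v ord_max].
Proof.
rewrite {1}(acons_eta v) (args1_eta (fun j => v (lift ord0 j))).
by congr acons; congr acons; congr v; apply: val_inj.
Qed.

Section PVModels.
Variables (M : structure pv) (hM : models M PV).
Implicit Type e : nat -> M.

Lemma value_args1 e (f : pv 1) a : value e (App f [args a]) = fn f [args value e a].
Proof. by rewrite value_acons; congr fn; congr acons; apply: anil_eq. Qed.

Lemma value_args2 e (f : pv 2) a b :
  value e (App f [args a; b]) = fn f [args value e a; value e b].
Proof. by rewrite value_acons map_acons; congr fn; do 2 congr acons; apply: anil_eq. Qed.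

(** The value of the numeral of [k]; by [nm_inj] and [fn_nm] this embeds the standard model into
    [M]. *)
Definition nm (k : nat) : M :=
  dyadic_rec (fn PvZero anil) (fun d _ r => fn (if d then PvS2 else PvS1) [args r]) k.

Lemma nmS d k : nm (dsucc d k) = fn (if d then PvS2 else PvS1) [args nm k].
Proof. exact: dyadic_recS. Qed.

Lemma value_num e k : value e (num k) = nm k.
Proof.
elim/dyadic_ind: k => [|d k IH]; first by congr fn; apply: anil_eq.
by rewrite /num dyadic_recS -/(num k) nmS; case: d; rewrite /sc1 /sc2 value_args1 IH.
Qed.

Lemma value_sc1 e t : value e (sc1 t) = fn PvS1 [args value e t].
Proof. exact: value_args1. Qed.
Lemma value_sc2 e t : value e (sc2 t) = fn PvS2 [args value e t].
Proof. exact: value_args1. Qed.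
Lemma value_tr e t : value e (tr t) = fn PvTr [args value e t].
Proof. exact: value_args1. Qed.
Lemma value_cat2 e s t : value e (cat2 s t) = fn PvCat [args value e s; value e t].
Proof. exact: value_args2. Qed.
Lemma value_smash e s t : value e (smash s t) = fn PvSmash [args value e s; value e t].
Proof. exact: value_args2. Qed.
Lemma value_less e s t : value e (less s t) = fn PvLess [args value e s; value e t].
Proof. exact: value_args2. Qed.
Lemma value_zero e : value e zero = nm 0.
Proof. exact: (value_num e 0). Qed.

Definition valueE :=
  (value_num, value_zero, value_sc1, value_sc2, value_tr, value_cat2, value_smash, value_less).

Let e0 : nat -> M := fun _ => nm 0.

Lemma axiom_eq s t : PV (Eq s t) -> value e0 s = value e0 t.
Proof. by move=> h; apply: (hM h e0). Qed.

Lemma axiom_neq s t : PV (Neq s t) -> value e0 s <> value e0 t.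
Proof. by move=> h; apply: (hM h e0). Qed.

Lemma nm_tr k : fn PvTr [args nm k] = nm (dtr k).
Proof.
elim/dyadic_ind: k => [|d k _].
  by have := axiom_eq pv_tr0; rewrite !valueE.
rewrite dtr_dsucc nmS; case: d.
  by have := axiom_eq (pv_tr2 (num k)); rewrite !valueE.
by have := axiom_eq (pv_tr1 (num k)); rewrite !valueE.
Qed.

Lemma nm_cat k l : fn PvCat [args nm k; nm l] = nm (dcat k l).
Proof.
elim/dyadic_ind: l => [|d l IH].
  by have := axiom_eq (pv_cat0 (num k)); rewrite !valueE.
rewrite dcatS !nmS -IH; case: d.
  by have := axiom_eq (pv_cat2 (num k) (num l)); rewrite !valueE.
by have := axiom_eq (pv_cat1 (num k) (num l)); rewrite !valueE.
Qed.

Lemma nm_smash k l : fn PvSmash [args nm k; nm l] = nm (dsmash k l).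
Proof.
elim/dyadic_ind: l => [|d l IH].
  by have := axiom_eq (pv_smash0 (num k)); rewrite !valueE.
rewrite dsmashS -nm_cat -IH nmS; case: d.
  by have := axiom_eq (pv_smash2 (num k) (num l)); rewrite !valueE.
by have := axiom_eq (pv_smash1 (num k) (num l)); rewrite !valueE.
Qed.

Lemma nm_less k l : fn PvLess [args nm k; nm l] = nm (dless k l).
Proof.
elim/dyadic_ind: l => [|d l IH].
  by have := axiom_eq (pv_less0 (num k)); rewrite !valueE.
rewrite dlessS -nm_tr -IH nmS; case: d.
  by have := axiom_eq (pv_less2 (num k) (num l)); rewrite !valueE.
by have := axiom_eq (pv_less1 (num k) (num l)); rewrite !valueE.
Qed.

Lemma value_cut_nm s t k l :
  value e0 s = nm k -> value e0 t = nm l -> value e0 (cut s t) = nm (dcut k l).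
Proof. by move=> hs ht; rewrite /cut !valueE hs ht !nm_less. Qed.

Lemma nm_inj : injective nm.
Proof.
elim/dyadic_ind => [|d k IH]; elim/dyadic_ind => [|d' k' _] //.
- case: d' => eq; rewrite nmS in eq.
    by case: (axiom_neq (pv_s2_neq0 (num k'))); rewrite !valueE.
  by case: (axiom_neq (pv_s1_neq0 (num k'))); rewrite !valueE.
- case: d => eq; rewrite nmS in eq.
    by case: (axiom_neq (pv_s2_neq0 (num k))); rewrite !valueE.
  by case: (axiom_neq (pv_s1_neq0 (num k))); rewrite !valueE.
- move=> eq; have eqk : k = k'.
    by apply: IH; rewrite -(dtr_dsucc d k) -(dtr_dsucc d' k') -!nm_tr eq.
  move: eq; rewrite eqk !nmS; case: d; case: d' => // eq.
    by case: (axiom_neq (pv_s1_neq_s2 (num k') (num k'))); rewrite !valueE.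
  by case: (axiom_neq (pv_s1_neq_s2 (num k') (num k'))); rewrite !valueE.
Qed.

(** The defining equations evaluate each function symbol on numerals; for [PvRec] this takes a
    second induction, on the notation of the recursion argument. *)
Lemma fn_nm n (f : pv n) v : fn f (fun j => nm (v j)) = nm (pv_std f v).
Proof.
elim: f v => {n} [|||||||n i|n m f IHf g IHg|n g IHg h1 IH1 h2 IH2 k IHk] v.
- by congr fn; apply: anil_eq.
- by rewrite (args1_eta (fun j => _)) -(nmS false).
- by rewrite (args1_eta (fun j => _)) -(nmS true).
- by rewrite (args1_eta (fun j => _)) nm_tr.
- by rewrite (args2_eta (fun j => _)) nm_cat.
- by rewrite (args2_eta (fun j => _)) nm_smash.
- by rewrite (args2_eta (fun j => _)) nm_less.
- have /= := axiom_eq (pv_proj i (fun j => num (v j))); rewrite value_num => <-.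
  by congr fn; apply: functional_extensionality => j; rewrite value_num.
- have vE : (fun j => value e0 (num (v j))) = (fun j => nm (v j)).
    by apply: functional_extensionality => j; rewrite value_num.
  have /= := axiom_eq (pv_comp f g (fun j => num (v j))); rewrite vE => ->.
  rewrite -IHf; congr fn; apply: functional_extensionality => j.
  exact: IHg.
- rewrite (acons_eta v).
  move: (v ord0) (fun j => v (lift ord0 j)) => {v} x y; rewrite map_acons.
  have yE : (fun j => value e0 (num (y j))) = (fun j => nm (y j)).
    by apply: functional_extensionality => j; rewrite value_num.
  have kE z : value e0 (App k (acons (num z) (fun j => num (y j)))) = nm (pv_std k (acons z y)).
    by rewrite value_acons yE value_num -map_acons IHk.
  have rE z : value e0 (App (PvRec g h1 h2 k) (acons (num z) (fun j => num (y j)))) =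
      fn (PvRec g h1 h2 k) (acons (nm z) (fun j => nm (y j))).
    by rewrite value_acons yE value_num.
  rewrite -rE; elim/dyadic_ind: x => [|d x IHx].
    rewrite -[num 0]/zero (axiom_eq (pv_rec0 _ _ _ _ _)) std_rec; apply: value_cut_nm.
      by rewrite /= yE IHg.
    exact: (kE 0).
  rewrite std_recS; have := kE (dsucc d x); rewrite /num dyadic_recS -/(num x) => kE'.
  case: d kE' => kE'.
    rewrite (axiom_eq (pv_rec2 _ _ _ _ _ _)); apply: value_cut_nm kE'.
    by rewrite value_acons map_acons IHx yE value_num -!map_acons IH2.
  rewrite (axiom_eq (pv_rec1 _ _ _ _ _ _)); apply: value_cut_nm kE'.
  by rewrite value_acons map_acons IHx yE value_num -!map_acons IH1.
Qed.

Lemma value_nm (e : nat -> nat) t :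
  value (fun i => nm (e i)) t = nm (value (M := std_model) e t).
Proof.
elim: t => //= n f v IH; rewrite -fn_nm; congr fn.
by apply: functional_extensionality => j; apply: IH.
Qed.

(** This carries facts about fixed ordinals, such as [inO R b] or [leO R b c], from the standard
    model to all models of PV. *)
Lemma sat_nm (e : nat -> nat) A : qfree A ->
  sat (fun i => nm (e i)) A <-> sat (M := std_model) e A.
Proof.
elim=> //= [s t|s t|B D _ IHB _ IHD|B D _ IHB _ IHD]; last 2 first.
- by rewrite IHB IHD.
- by rewrite IHB IHD.
- by rewrite !value_nm; split=> [/nm_inj|->].
- by rewrite !value_nm; split=> h1 h2; apply: h1; [rewrite h2|apply: nm_inj].
Qed.

End PVModels.

Lemma PV_complete A :
  (forall M, models M PV -> forall e : nat -> M, sat e A) -> proves PV A.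
Proof. exact: completeness form_code_inj. Qed.

(** * Ordinals in models of PV *)

Section OrdinalOperations.
Variables (R : ord_notation) (hs : well_scoped R) (M : structure pv).
Implicit Types (e : nat -> M) (x y : M).

(** Here and below the environment repeats its last argument beyond the variables of the formula or
    term; [well_scoped] makes this padding harmless. *)
Definition mO x : Prop := sat (fun _ => x) (on_O R).
Definition mlt x y : Prop := sat (scons x (fun _ => y)) (on_lt R).
Definition mle x y : Prop := mlt x y \/ x = y.
Definition mop (t : term pv) x y : M := value (scons x (fun _ => y)) t.
Definition mo x : M := value (fun _ => x) (on_o R).
Local Notation madd := (mop (on_add R)).
Local Notation mmul := (mop (on_mul R)).
Local Notation msub := (mop (on_sub R)).
Local Notation mdiv := (mop (on_div R)).

Lemma sat_Of e t : sat e (Of R t) = mO (value e t).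
Proof.
case: hs => -[_ h] _ _ _ _; rewrite /Of sat_finst.
by apply: (sat_scoped h) => -[].
Qed.

Lemma sat_Lt e s t : sat e (Lt R s t) = mlt (value e s) (value e t).
Proof.
case: hs => _ [_ h] _ _ _; rewrite /Lt /fapp2 sat_fsubst.
by apply: (sat_scoped h) => -[|[]].
Qed.

Lemma sat_Le e s t : sat e (Le R s t) = mle (value e s) (value e t).
Proof. by rewrite /= sat_Lt. Qed.

Lemma value_tapp2 e u s t : tscoped 2 u ->
  value e (tapp2 u s t) = mop u (value e s) (value e t).
Proof. by move=> h; rewrite /tapp2 value_tsubst; apply: (value_scoped h) => -[|[]]. Qed.

Lemma value_add e s t : value e (tapp2 (on_add R) s t) = madd (value e s) (value e t).
Proof. by apply: value_tapp2; case: hs => _ _ []. Qed.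
Lemma value_mul e s t : value e (tapp2 (on_mul R) s t) = mmul (value e s) (value e t).
Proof. by apply: value_tapp2; case: hs => _ _ []. Qed.
Lemma value_sub e s t : value e (tapp2 (on_sub R) s t) = msub (value e s) (value e t).
Proof. by apply: value_tapp2; case: hs => _ _ _ []. Qed.
Lemma value_div e s t : value e (tapp2 (on_div R) s t) = mdiv (value e s) (value e t).
Proof. by apply: value_tapp2; case: hs => _ _ _ []. Qed.

Lemma value_o e t : value e (tapp1 (on_o R) t) = mo (value e t).
Proof.
case: hs => _ _ _ _ h; rewrite /tapp1 value_tsubst.
by apply: (value_scoped h) => -[].
Qed.

Lemma sat_AllO e A : sat e (AllO R A) <-> (forall x, mO x -> sat (scons x e) A).
Proof.
rewrite /AllO [sat _ _]/=; split=> h x; have := h x.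
  by rewrite -/(sat _ (Imp _ _)) ?sat_neg ?sat_Of /=; case: (classic (mO x)); tauto.
by rewrite ?sat_neg ?sat_Of /=; case: (classic (mO x)); tauto.
Qed.

Lemma sat_AllLt e t A : sat e (AllLt R t A) <->
  (forall x, mO x -> mlt x (value e t) -> sat (scons x e) A).
Proof.
rewrite /AllLt sat_AllO; split=> h x hx; have := h x hx;
  by rewrite sat_Imp sat_Lt value_tshift.
Qed.

End OrdinalOperations.

(** * Ordinal arithmetic in an arbitrary model of PV *)

Section OrdinalLaws.
Variables (R : ord_notation) (hs : well_scoped R) (hl : pv_laws R).
Variables (M : structure pv) (hM : models M PV).
Implicit Types (e : nat -> M) (x y z : M).

Local Notation O := (@mO R M).
Local Notation "x ≺ y" := (mlt R x y) (at level 70).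
Local Notation "x ⪯ y" := (mle R x y) (at level 70).
Local Notation "x ⊕ y" := (mop (on_add R) x y) (at level 50, left associativity).
Local Notation "x ⊗ y" := (mop (on_mul R) x y) (at level 40, left associativity).
Local Notation "x ⊖ y" := (mop (on_sub R) x y) (at level 50, left associativity).
Local Notation "x ⊘ y" := (mop (on_div R) x y) (at level 40, left associativity).
Local Notation "'𝟎'" := (nm M (on_0 R)).
Local Notation "'𝟏'" := (nm M (on_1 R)).

Lemma pvO_sat k A e : pvO R k A -> (forall i, i < k -> O (e i)) -> sat e A.
Proof.
move=> /(proves_sound hM) /(_ e) + he.
(* The guards start at variable 0; the induction needs them from an arbitrary variable on. *)
have {}he i : i < 0 + k -> O (e i) by apply: he.
elim: k 0 he => [|k IH] m he //.
change (sat e (Imp (Of R (Var m))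
          (foldr (fun i B => Imp (Of R (Var i)) B) A (iota m.+1 k))) -> sat e A).
rewrite sat_Imp sat_Of // => h.
apply: (IH m.+1) => [i hi|]; first by apply: he; rewrite -addSnnS.
by apply: h; apply: he; rewrite -addSnnS leq_addr.
Qed.

Definition satE :=
  (sat_Imp, sat_Of hs, sat_Lt hs, sat_Le hs, value_add hs, value_mul hs, value_sub hs,
   value_div hs, value_o hs, value_num).

Lemma law1 A x : pvO R 1 A -> O x -> sat (fun _ => x) A.
Proof. by move=> h hx; apply: (pvO_sat h). Qed.

Lemma law2 A x y : pvO R 2 A -> O x -> O y -> sat (scons x (fun _ => y)) A.
Proof. by move=> h hx hy; apply: (pvO_sat h) => -[|[]]. Qed.

Lemma law3 A x y z : pvO R 3 A -> O x -> O y -> O z ->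
  sat (scons x (scons y (fun _ => z))) A.
Proof. by move=> h hx hy hz; apply: (pvO_sat h) => -[|[|[]]]. Qed.

Lemma lt_irr x : O x -> ~ x ≺ x.
Proof. by move=> /(law1 (law_irrefl hl)); rewrite sat_neg !satE. Qed.

Lemma lt_trans x y z : O x -> O y -> O z -> x ≺ y -> y ≺ z -> x ≺ z.
Proof. by move=> hx hy hz; have := law3 (law_trans hl) hx hy hz; rewrite !satE. Qed.

Lemma lt_total x y : O x -> O y -> x ≺ y \/ x = y \/ y ≺ x.
Proof. by move=> hx hy; have := law2 (law_total hl) hx hy; rewrite /= !satE. Qed.

Lemma O0 : O 𝟎.
Proof. by have := proves_sound hM (law_zeroO hl) (fun=> 𝟎); rewrite !satE. Qed.

Lemma O1 : O 𝟏.
Proof. by have := proves_sound hM (law_oneO hl) (fun=> 𝟎); rewrite !satE. Qed.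

Lemma le0 x : O x -> 𝟎 ⪯ x.
Proof. by move=> /(law1 (law_min hl)); rewrite !satE. Qed.

Lemma addO x y : O x -> O y -> O (x ⊕ y).
Proof. by move=> hx hy; have := law2 (law_addO hl) hx hy; rewrite !satE. Qed.

Lemma mulO x y : O x -> O y -> O (x ⊗ y).
Proof. by move=> hx hy; have := law2 (law_mulO hl) hx hy; rewrite !satE. Qed.

Lemma subO x y : O x -> O y -> O (x ⊖ y).
Proof. by move=> hx hy; have := law2 (law_subO hl) hx hy; rewrite !satE. Qed.

Lemma divO x y : O x -> O y -> y <> 𝟎 -> O (x ⊘ y).
Proof. by move=> hx hy; have := law2 (law_divO hl) hx hy; rewrite !satE /= ?satE. Qed.

Lemma discrete x y : O x -> O y -> y ≺ x ⊕ 𝟏 -> y ⪯ x.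
Proof. by move=> hx hy; have := law2 (law_discrete hl) hx hy; rewrite !satE /= ?satE. Qed.

Lemma mulDr x y z : O x -> O y -> O z -> x ⊗ (y ⊕ z) = x ⊗ y ⊕ x ⊗ z.
Proof. by move=> hx hy hz; have := law3 (law_distr hl) hx hy hz; rewrite /= !satE. Qed.

Lemma addr0 x : O x -> x ⊕ 𝟎 = x.
Proof. by move=> /(law1 (law_addr0 hl)); rewrite /= !satE. Qed.

Lemma add0r x : O x -> 𝟎 ⊕ x = x.
Proof. by move=> /(law1 (law_add0r hl)); rewrite /= !satE. Qed.

Lemma mulr1 x : O x -> x ⊗ 𝟏 = x.
Proof. by move=> /(law1 (law_mulr1 hl)); rewrite /= !satE. Qed.

Lemma mulr0 x : O x -> x ⊗ 𝟎 = 𝟎.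
Proof. by move=> /(law1 (law_mulr0 hl)); rewrite /= !satE. Qed.

Lemma add_lt x y z : O x -> O y -> O z -> z ≺ y -> x ⊕ z ≺ x ⊕ y.
Proof. by move=> hx hy hz; have := law3 (law_addlt hl) hx hy hz; rewrite !satE. Qed.

Lemma mul_lt x y z : O x -> O y -> O z -> x <> 𝟎 -> z ≺ y -> x ⊗ z ≺ x ⊗ y.
Proof.
by move=> hx hy hz h0 h; have := law3 (law_mullt hl) hx hy hz; rewrite !satE /= ?satE; auto.
Qed.

Lemma sub_ge x y : O x -> O y -> y ⪯ x -> x = y ⊕ (x ⊖ y).
Proof. by move=> hx hy; have := law2 (law_sub_ge hl) hx hy; rewrite !satE /= ?satE. Qed.

Lemma div_le x y : O x -> O y -> y <> 𝟎 -> y ⊗ (x ⊘ y) ⪯ x.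
Proof. by move=> hx hy; have := law2 (law_div_le hl) hx hy; rewrite !satE /= ?satE. Qed.

Lemma div_rem x y : O x -> O y -> y <> 𝟎 -> x ⊖ y ⊗ (x ⊘ y) ≺ y.
Proof. by move=> hx hy; have := law2 (law_div_rem hl) hx hy; rewrite !satE /= ?satE. Qed.

Hint Resolve O0 O1 le0 addO mulO subO divO : core.

(** Strictness is taken from [o], which preserves the order and sends the numerals 0 and 1 to 𝟎 and
    𝟏. That 0 < 1 holds for numerals in [M] is a computation in the standard model. *)
Lemma lt01 : 𝟎 ≺ 𝟏.
Proof.
have o0 := proves_sound hM (law_o_0 hl) (fun=> 𝟎).
have o1 := proves_sound hM (law_o_1 hl) (fun=> 𝟎).
rewrite /= !satE in o0 o1.
have := proves_sound hM (law_o_lt hl) (scons (nm M 0) (fun=> nm M 1)).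
rewrite sat_Iff !satE /= o0 o1 => <-.
change (value (M := M) (scons (nm M 0) (fun=> nm M 1)) (App PvLt [args Var 0; Var 1]) =
        value (M := M) (scons (nm M 0) (fun=> nm M 1)) (num 1)).
rewrite value_args2 value_num /=.
have -> : [args nm M 0; nm M 1] = (fun j => nm M ([args 0; 1] j)).
  by rewrite !map_acons; do 2 congr acons; apply: anil_eq.
by rewrite fn_nm //; vm_compute.
Qed.

Lemma le_lt_trans x y z : O x -> O y -> O z -> x ⪯ y -> y ≺ z -> x ≺ z.
Proof. by move=> hx hy hz [h1|-> //]; apply: lt_trans. Qed.

Lemma lt_le_trans x y z : O x -> O y -> O z -> x ≺ y -> y ⪯ z -> x ≺ z.
Proof. by move=> hx hy hz h1 [h2|<- //]; apply: lt_trans h2. Qed.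

Lemma le_trans x y z : O x -> O y -> O z -> x ⪯ y -> y ⪯ z -> x ⪯ z.
Proof. by move=> hx hy hz h1 [h2|<- //]; left; apply: le_lt_trans h2. Qed.

Lemma le_or_lt x y : O x -> O y -> x ⪯ y \/ y ≺ x.
Proof. by move=> hx hy; rewrite /mle; have := lt_total hx hy; tauto. Qed.

Lemma le_not_lt x y : O x -> O y -> x ⪯ y -> ~ y ≺ x.
Proof. by move=> hx hy h1 h2; apply: (lt_irr hx); apply: le_lt_trans h2. Qed.

Lemma neq0_lt x : O x -> x <> 𝟎 -> 𝟎 ≺ x.
Proof. by move=> hx ne; case: (le0 hx) => // eq; case: ne. Qed.

Lemma succ_le x y : O x -> O y -> x ≺ y -> x ⊕ 𝟏 ⪯ y.
Proof.
move=> hx hy h; case: (@le_or_lt (x ⊕ 𝟏) y); auto => /(discrete hx hy) h'.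
by case: (le_not_lt _ _ h').
Qed.

Lemma lt_succ x : O x -> x ≺ x ⊕ 𝟏.
Proof. by move=> hx; rewrite -{1}(addr0 hx); apply: add_lt; auto; apply: lt01. Qed.

Lemma one_le x : O x -> x <> 𝟎 -> 𝟏 ⪯ x.
Proof.
by move=> hx ne; rewrite -(add0r O1); apply: succ_le; auto; apply: neq0_lt.
Qed.

Lemma one_le_neq0 x : O x -> 𝟏 ⪯ x -> x <> 𝟎.
Proof. by move=> hx h eq; apply: (le_not_lt _ _ h); auto; rewrite eq; apply: lt01. Qed.

Lemma add_lt_inv x y z : O x -> O y -> O z -> x ⊕ z ≺ x ⊕ y -> z ≺ y.
Proof.
move=> hx hy hz h; case: (@le_or_lt y z) => // -[h'|eq].
  by case: (lt_irr (x := x ⊕ y)); auto; apply: lt_trans h; auto; apply: add_lt.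
by move: h; rewrite eq => /lt_irr []; auto.
Qed.

Lemma add_inj x y z : O x -> O y -> O z -> x ⊕ z = x ⊕ y -> z = y.
Proof.
move=> hx hy hz eq; case: (lt_total hy hz) => [h|[-> //|h]].
  by have := add_lt hx hz hy h; rewrite eq => /lt_irr []; auto.
by have := add_lt hx hy hz h; rewrite eq => /lt_irr []; auto.
Qed.

Lemma le_addr x y : O x -> O y -> x ⪯ x ⊕ y.
Proof.
move=> hx hy; rewrite -{1}(addr0 hx); case: (le0 hy) => [h|<-]; last by right.
by left; apply: add_lt.
Qed.

Lemma addK x y : O x -> O y -> (x ⊕ y) ⊖ x = y.
Proof.
move=> hx hy; apply: (@add_inj x); auto.
by rewrite -sub_ge; auto; apply: le_addr.
Qed.

Lemma add_le_inv x y z : O x -> O y -> O z -> x ⊕ z ⪯ x ⊕ y -> z ⪯ y.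
Proof.
by move=> hx hy hz [/add_lt_inv h|/add_inj h]; [left; apply: h|right; apply: h].
Qed.

Lemma mul_le x y z : O x -> O y -> O z -> x <> 𝟎 -> z ⪯ y -> x ⊗ z ⪯ x ⊗ y.
Proof. by move=> hx hy hz h0 [h|->]; [left; apply: mul_lt|right]. Qed.

Lemma divide b x : O b -> O x -> b <> 𝟎 -> x = b ⊗ (x ⊘ b) ⊕ (x ⊖ b ⊗ (x ⊘ b)).
Proof. by move=> hb hx h0; apply: sub_ge; auto; apply: div_le. Qed.

(** b·d + r ≺ b·d + b = b·(d + 𝟏) ⪯ b·d', so blocks of length b follow one another without
    overlap. *)
Lemma block_lt b d d' r : O b -> O d -> O d' -> O r -> b <> 𝟎 ->
  r ≺ b -> d ≺ d' -> b ⊗ d ⊕ r ≺ b ⊗ d'.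
Proof.
move=> hb hd hd' hr h0 hrb hdd.
apply: (@lt_le_trans _ (b ⊗ d ⊕ b)); auto; first by apply: add_lt; auto.
have -> : b ⊗ d ⊕ b = b ⊗ (d ⊕ 𝟏) by rewrite mulDr; auto; rewrite mulr1.
by apply: mul_le; auto; apply: succ_le.
Qed.

(** Two different quotients would put one element into two blocks, against [block_lt]; once the
    quotients agree, the remainder is found by left cancellation. *)
Lemma divide_uniq b d r : O b -> O d -> O r -> b <> 𝟎 -> r ≺ b ->
  (b ⊗ d ⊕ r) ⊘ b = d /\ (b ⊗ d ⊕ r) ⊖ b ⊗ ((b ⊗ d ⊕ r) ⊘ b) = r.
Proof.
move=> hb hd hr h0 hrb; set x := b ⊗ d ⊕ r.
have hx : O x by rewrite /x; auto.
have eqx := divide hb hx h0; have hq : O (x ⊘ b) by auto.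
have hrem := div_rem hx hb h0; set q := x ⊘ b in eqx hq hrem *.
set s := x ⊖ b ⊗ q in eqx hrem *; have hss : O s by rewrite /s; auto.
suff eq : q = d by split=> //; rewrite /s eq addK; auto.
case: (lt_total hq hd) => [h|[//|h]].
  have := block_lt hb hq hd hss h0 hrem h; rewrite -eqx /x => h'.
  by case: (@le_not_lt (b ⊗ d) (b ⊗ d ⊕ r)); auto; apply: le_addr; auto.
have := block_lt hb hd hq hr h0 hrb h; rewrite -/x eqx => h'.
by case: (@le_not_lt (b ⊗ q) (b ⊗ q ⊕ s)); auto; apply: le_addr; auto.
Qed.

End OrdinalLaws.

Lemma nm_std k : nm std_model k = k.
Proof. by elim/dyadic_ind: k => // -[] k IH; rewrite nmS IH. Qed.

(** * Flows *)

Section Flows.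
Variables (R : ord_notation) (hs : well_scoped R) (hl : pv_laws R).
Implicit Types (M : structure pv) (A B H : form pv).

Lemma inOE b : inO R b = mO R (M := std_model) b.
Proof. exact: stdE. Qed.

Lemma leOE b c : leO R b c = mle R (M := std_model) b c.
Proof. by rewrite /leO /ltO stdE. Qed.

Lemma mO_nm M (hM : models M PV) b : inO R b -> mO R (nm M b).
Proof. by rewrite inOE => hb; apply/(sat_nm hM (fun=> b)) => //; case: hs => -[]. Qed.

Lemma mle_nm M (hM : models M PV) b c : leO R b c -> mle R (nm M b) (nm M c).
Proof.
rewrite leOE => -[h|->]; [left|by right].
have [_ [hq _] _ _ _] := hs; have := (sat_nm hM (scons b (fun=> c)) hq).2 h.
by congr sat; apply: functional_extensionality => -[].
Qed.

Lemma nm_mop M (hM : models M PV) t b c :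
  nm M (mop (M := std_model) t b c) = mop t (nm M b) (nm M c).
Proof.
rewrite /mop -value_nm //; congr value.
by apply: functional_extensionality => -[].
Qed.

(** Semantic form of [is_flow], with no bound on the parameters of [H]. *)
Definition flow_at M (e : nat -> M) A B H beta : Prop :=
  [/\ sat e A <-> sat (scons (nm M (on_0 R)) e) H,
      forall d, mO R d -> mle R (nm M (on_1 R)) d -> mle R d (nm M beta) ->
        (forall c, mO R c -> mlt R c d -> sat (scons c e) H) -> sat (scons d e) H
    & sat (scons (nm M beta) e) H <-> sat e B].

Definition flow A B : Prop := exists H beta,
  [/\ forall1 H, inO R beta, leO R (on_1 R) beta
    & forall M, models M PV -> forall e : nat -> M, flow_at e A B H beta].

Definition entails A B : Prop :=
  forall M, models M PV -> forall e : nat -> M, sat e A -> sat e B.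

Lemma inO1 : inO R (on_1 R).
Proof. by rewrite inOE -[on_1 R]nm_std; apply: (O1 hs hl PV_std). Qed.

Lemma leO_refl b : leO R b b.
Proof. by right. Qed.

Lemma forall1_fshift A : forall1 A -> forall1 (fshift A).
Proof. exact: forall1_fsubst. Qed.

Lemma forall1_Lt s t : forall1 (Lt R s t) /\ forall1 (neg (Lt R s t)).
Proof.
have [_ [hq _] _ _ _] := hs.
by split; apply: qfree_forall1; rewrite ?neg_fsubst; apply: qfree_fsubst; rewrite ?neg_fsubst;
  try apply: qfree_neg.
Qed.

Lemma forall1_Of t : forall1 (Of R t) /\ forall1 (neg (Of R t)).
Proof.
have [[hq _] _ _ _ _] := hs.
by split; apply: qfree_forall1; rewrite ?neg_fsubst; apply: qfree_fsubst; rewrite ?neg_fsubst;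
  try apply: qfree_neg.
Qed.

Lemma forall1_AllLt t A : forall1 A -> forall1 (AllLt R t A).
Proof.
by move=> hA; do ! constructor; auto;
  [case: (forall1_Of (Var 0))|case: (forall1_Lt (Var 0) (tshift t))].
Qed.

(** A flow of length 𝟏 does it: position 𝟎 carries [A], every other position carries [B], and the
    only step is the implication. *)
Lemma flow_entails A B : forall1 A -> forall1 B -> entails A B -> flow A B.
Proof.
move=> hA hB hAB.
exists (And (Or (Neq (Var 0) (num (on_0 R))) (fshift A))
            (Or (Eq (Var 0) (num (on_0 R))) (fshift B))), (on_1 R).
split; [by do ! constructor; apply: forall1_fshift|exact: inO1|exact: leO_refl|].
move=> M hM e; split.
- by rewrite /= !value_num !sat_fshift; tauto.
- move=> d hd h1 _ /(_ _ (O0 hs hl hM)); rewrite /= !value_num !sat_fshift => h.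
  have ne : d <> nm M (on_0 R) by apply: (one_le_neq0 hs hl hM hd h1).
  split; first by left.
  by right; apply: (hAB M hM); have [[|]] := h (neq0_lt hs hl hM hd ne).
- have ne := one_le_neq0 hs hl hM (O1 hs hl hM) (or_intror erefl).
  by rewrite /= !value_num !sat_fshift; tauto.
Qed.

Lemma value_scons M (e : nat -> M) (t : term pv) s :
  (fun i => value e (scons t s i)) = scons (value e t) (fun i => value e (s i)).
Proof. by apply: functional_extensionality => -[]. Qed.

(** The second flow is run on the left subtraction of the length of the first. *)
Lemma flow_trans A B D : flow A B -> flow B D -> flow A D.
Proof.
move=> [H1 [b1 [f1 O1b le1 F1]]] [H2 [b2 [f2 O2b le2 F2]]].
pose sub := tapp2 (on_sub R) (Var 0) (num b1).
pose H2' := fsubst (scons sub (fun i => Var i.+1)) H2.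
(* The second flow takes over strictly above [b1]. Its own position 𝟎 would fall on [b1], where the
   first flow speaks. *)
pose H := And (Or (Lt R (num b1) (Var 0)) H1)
              (Or (neg (Lt R (num b1) (Var 0))) H2').
pose b := mop (M := std_model) (on_add R) b1 b2.
have Ob : inO R b by rewrite inOE; apply: (addO hs hl PV_std); rewrite -inOE.
have HE M (e : nat -> M) x : sat (scons x e) H <->
    (mlt R (nm M b1) x \/ sat (scons x e) H1) /\
    (~ mlt R (nm M b1) x \/ sat (scons (mop (on_sub R) x (nm M b1)) e) H2).
  rewrite /= sat_neg !sat_Lt // !value_num /H2' sat_fsubst value_scons.
  by rewrite /sub value_sub // value_num.
exists H, b; split=> //.
- have [h1 h2] := forall1_Lt (num b1) (Var 0).
  by do ! constructor=> //; apply: forall1_fsubst.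
- have := le_trans hs hl PV_std (x := on_1 R) (y := b1) (z := b).
  rewrite -!inOE -!leOE; apply=> //; first exact: inO1.
  by rewrite leOE; apply: (le_addr hs hl PV_std); rewrite -inOE.
move=> M hM e; have [s1 p1 t1] := F1 M hM e; have [s2 p2 t2] := F2 M hM e.
have O1m := mO_nm hM O1b; have O2m := mO_nm hM O2b; have Om := mO_nm hM Ob.
have O0m := O0 hs hl hM; have l1 := mle_nm hM le1; have l2 := mle_nm hM le2.
have bE : nm M b = mop (on_add R) (nm M b1) (nm M b2) by apply: nm_mop.
have lt0 c : mO R c -> ~ mlt R c (nm M (on_0 R)).
  by move=> hc; apply: (le_not_lt hs hl hM) => //; apply: (le0 hs hl hM).
split.
- by rewrite HE s1; have := lt0 _ O1m; tauto.
- move=> d hd d1 db hyp; apply/HE.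
  case: (le_or_lt hs hl hM hd O1m) => hdb.
    have nlt := le_not_lt hs hl hM hd O1m hdb; split; [right|by left].
    apply: p1 => // c hc hcd; have [[h|//] _] := (HE _ _ _).1 (hyp c hc hcd).
    by case: nlt; apply: (lt_trans hs hl hM) hcd.
  split; [by left|right].
  have dE : d = mop (on_add R) (nm M b1) (mop (on_sub R) d (nm M b1)).
    by apply: (sub_ge hs hl hM) => //; left.
  set x := mop (on_sub R) d (nm M b1) in dE *.
  have hx : mO R x by apply: (subO hs hl hM).
  have x0 : x <> nm M (on_0 R).
    move=> x0; move: hdb; rewrite {1}dE x0 (addr0 hs hl hM O1m).
    exact: (lt_irr hs hl hM).
  apply: p2 => //.
  + exact: (one_le hs hl hM).
  + by apply: (add_le_inv hs hl hM (x := nm M b1)) => //; rewrite -dE -bE.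
  + move=> c hc hcx.
    have hcd : mlt R (mop (on_add R) (nm M b1) c) d by rewrite dE; apply: (add_lt hs hl hM).
    have hbc : mO R (mop (on_add R) (nm M b1) c) by apply: (addO hs hl hM).
    have [h3 h4] := (HE _ _ _).1 (hyp _ hbc hcd).
    rewrite (addK hs hl hM) // in h4.
    (* Handover: at [b1] only the first flow is known, and its end [B] is the beginning of the
       second. *)
    case: (classic (c = nm M (on_0 R))) => c0.
      rewrite c0 -s2 -t1; move: h3; rewrite c0 (addr0 hs hl hM) // => -[|//].
      by move=> /(lt_irr hs hl hM).
    case: h4 => // -[]; rewrite -{1}(addr0 hs hl hM O1m).
    by apply: (add_lt hs hl hM) => //; apply: (neq0_lt hs hl hM).
- have lt : mlt R (nm M b1) (nm M b).
    rewrite bE -{1}(addr0 hs hl hM O1m); apply: (add_lt hs hl hM) => //.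
    by apply: (neq0_lt hs hl hM) => //; apply: (one_le_neq0 hs hl hM).
  by rewrite HE bE (addK hs hl hM) // -bE t2; tauto.
Qed.

Lemma flow_conv A A' B B' : forall1 A -> forall1 A' -> forall1 B -> forall1 B' ->
  entails A A' -> entails B' B -> flow A' B' -> flow A B.
Proof.
move=> hA hA' hB hB' h1 h2 h; apply: (flow_trans (flow_entails hA hA' h1)).
by apply: (flow_trans h); apply: flow_entails.
Qed.

Lemma flow_and A B D : forall1 D -> flow A B -> flow (And A D) (And B D).
Proof.
move=> hD [H [b [f1 Ob le F]]]; exists (And H (fshift D)), b; split=> //.
  by constructor=> //; apply: forall1_fshift.
move=> M hM e; have [s p t] := F M hM e; split.
- by rewrite /= sat_fshift s.
- move=> d hd d1 db h.
  (* [D] is the same at all positions, so it can be read off at position 𝟎, which lies below [d]. *)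
  have lt0 : mlt R (nm M (on_0 R)) d.
    by apply: (neq0_lt hs hl hM) => //; apply: (one_le_neq0 hs hl hM).
  have [_ h0] := h _ (O0 hs hl hM) lt0.
  split; last by move: h0; rewrite -/(sat _ _) -/(sat _ _) !sat_fshift.
  by apply: p => // c hc hcd; have [] := h c hc hcd.
- by rewrite /= sat_fshift t.
Qed.

Lemma flow_or A B D : forall1 D -> flow A B -> flow (Or A D) (Or B D).
Proof.
move=> hD [H [b [f1 Ob le F]]]; exists (Or H (fshift D)), b; split=> //.
  by constructor=> //; apply: forall1_fshift.
move=> M hM e; have [s p t] := F M hM e; split.
- by rewrite /= sat_fshift s.
- move=> d hd d1 db h; case: (classic (sat e D)) => hDe.
    by right; rewrite -(sat_fshift e d) in hDe.
  left; apply: p => // c hc hcd; have [//|] := h c hc hcd.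
  by rewrite -/(sat _ _) sat_fshift.
- by rewrite /= sat_fshift t.
Qed.

(** The length of a flow does not depend on the parameters, so the flows for all values of the
    variable run in parallel. The substitution exchanges position and variable, because the position
    has to stay outside the new quantifier. *)
Lemma flow_all A B : flow A B -> flow (All A) (All B).
Proof.
move=> [H [b [f1 Ob le F]]].
exists (All (fsubst (scons (Var 1) (scons (Var 0) (fun i => Var i.+2))) H)), b; split=> //.
  by constructor; apply: forall1_fsubst.
have HE M (e : nat -> M) x y :
    sat (scons y (scons x e)) (fsubst (scons (Var 1) (scons (Var 0) (fun i => Var i.+2))) H) =
    sat (scons x (scons y e)) H.
  by rewrite sat_fsubst !value_scons.
move=> M hM e; split.
- by split=> /= h y; have [s p t] := F M hM (scons y e); [rewrite HE -s|rewrite s -HE].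
- move=> d hd d1 db h /= y; have [s p t] := F M hM (scons y e); rewrite HE; apply: p => // c hc hcd.
  by rewrite -HE; apply: h.
- by split=> /= h y; have [s p t] := F M hM (scons y e); [rewrite -t -HE|rewrite HE t].
Qed.

Lemma flow_subst r A B : flow A B -> flow (fsubst r A) (fsubst r B).
Proof.
move=> [H [b [f1 Ob le F]]]; exists (fsubst (up r) H), b; split=> //.
  exact: forall1_fsubst.
move=> M hM e; have [s p t] := F M hM (fun i => value e (r i)); split.
- by rewrite !sat_fsubst value_up.
- move=> d hd d1 db h; rewrite sat_fsubst value_up; apply: p => // c hc hcd.
  by rewrite -value_up -sat_fsubst; apply: h.
- by rewrite !sat_fsubst value_up.
Qed.

End Flows.

(** * Closure of flows under transfinite induction *)

Section TransfiniteInduction.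
Variables (R : ord_notation) (hs : well_scoped R) (hl : pv_laws R).
Implicit Types (M : structure pv) (A B H : form pv).

Definition below A : form pv :=
  AllLt R (Var 0) (fsubst (scons (Var 0) (fun i => Var i.+2)) A).

Lemma sat_below M (e : nat -> M) d A : sat (scons d e) (below A) <->
  (forall c, mO R c -> mlt R c d -> sat (scons c e) A).
Proof.
rewrite sat_AllLt //; split=> h c hc hcd; have := h c hc hcd;
  by rewrite sat_fsubst value_scons.
Qed.

Lemma sat_AllO_below M (e : nat -> M) A : sat e (AllO R (Imp (below A) A)) <->
  (forall d, mO R d -> (forall c, mO R c -> mlt R c d -> sat (scons c e) A) ->
     sat (scons d e) A).
Proof.
rewrite sat_AllO //; split=> h d hd; have := h d hd; rewrite sat_Imp => h'.
  by move=> h''; apply: h'; apply/sat_below.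
by move=> /sat_below; apply: h'.
Qed.

Lemma forall1_below A : forall1 A -> forall1 (below A).
Proof. by move=> hA; apply: forall1_AllLt => //; apply: forall1_fsubst. Qed.

(** With β the length of the premise, position [β·δ + ε] of the new flow is
    position ε of the flow from [G ∧ (∀γ≺δ A(γ) ∨ D)] to
    [G ∧ (∀γ≺δ+1 A(γ) ∨ D)]. Reaching [β·δ] requires no case distinction between
    limits and successors: all blocks δ' ≺ δ have then been completed. *)
Lemma flow_ti A G D theta : forall1 A -> forall1 G -> forall1 D -> inO R theta ->
  flow R (And (Of R (Var 0)) (And (below A) (fshift G))) (Or A (fshift D)) ->
  flow R G (Or (finst A (num theta)) D).
Proof.
move=> hA hG hD Oth prem.
have hO := (forall1_Of hs (Var 0)).1; have hP := forall1_below hA.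
have hG' := forall1_fshift hG; have hD' := forall1_fshift hD.
(* [G] is carried through each block, which lets it be recovered at the start of a later one. [D]
   stays as an alternative that, when true, settles the disjunction in every block. *)
pose K := And (Of R (Var 0)) (And (fshift G) (Or (below A) (fshift D))).
pose K' := And (Of R (Var 0)) (And (fshift G) (Or (And (below A) A) (fshift D))).
have hK : forall1 K by rewrite /K; auto using f1_and, f1_or.
have hK' : forall1 K' by rewrite /K'; auto using f1_and, f1_or.
have step : flow R K K'.
  (* [D] is disjoined so that [K] suffices to start the premise; [K] is conjoined so that [G] and
     the induction hypothesis are still there at the end. *)
  have := flow_and hs hl hK (flow_or hD' prem).
  apply: flow_conv => //; try by auto using f1_and, f1_or, f1_top, f1_bot.
    by move=> M hM e /= [? [? [?|?]]]; tauto.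
  by move=> M hM e /= [[[?|?]|?] [? [? [?|?]]]]; tauto.
have {prem}[H [b [f1 Ob leb F]]] := step.
pose q := tapp2 (on_div R) (Var 0) (num b).
pose r := tapp2 (on_sub R) (Var 0) (tapp2 (on_mul R) (num b) q).
pose H' := fsubst (scons r (scons q (fun i => Var i.+1))) H.
have H'E M (e : nat -> M) x : sat (scons x e) H' =
    sat (scons (mop (on_sub R) x (mop (on_mul R) (nm M b) (mop (on_div R) x (nm M b))))
          (scons (mop (on_div R) x (nm M b)) e)) H.
  rewrite /H' sat_fsubst !value_scons /r /q.
  by rewrite value_sub // value_mul // value_div // value_num.
have KE M (e : nat -> M) d : mO R d -> sat (scons d e) K <->
    sat e G /\ ((forall c, mO R c -> mlt R c d -> sat (scons c e) A) \/ sat e D).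
  move=> hd; rewrite /K !(sat_And, sat_Or) sat_Of // !sat_fshift sat_below; tauto.
have K'E M (e : nat -> M) d : sat (scons d e) K' ->
    sat e G /\ (sat (scons d e) A \/ sat e D).
  by rewrite /K' !(sat_And, sat_Or) !sat_fshift; tauto.
(* The run stops at the opening of block θ + 1: there [K] gives A(γ) for all γ ≺ θ + 1, in
   particular A(θ). *)
pose th1 := mop (M := std_model) (on_add R) theta (on_1 R).
pose L := mop (M := std_model) (on_mul R) b th1.
have Oth1 : inO R th1 by rewrite inOE; apply: (addO hs hl PV_std); rewrite -inOE //; apply: inO1.
have OL : inO R L by rewrite inOE; apply: (mulO hs hl PV_std); rewrite -inOE.
have block M (hM : models M PV) (e : nat -> M) d c : mO R d -> mO R c -> mlt R c (nm M b) ->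
    sat (scons (mop (on_add R) (mop (on_mul R) (nm M b) d) c) e) H' = sat (scons c (scons d e)) H.
  move=> hd hc hcb; have hb := mO_nm hs hM Ob.
  have b0 := one_le_neq0 hs hl hM hb (mle_nm hs hM leb).
  have [dE rE] := divide_uniq hs hl hM hb hd hc b0 hcb.
  by rewrite H'E rE dE.
have start M (hM : models M PV) (e : nat -> M) d : mO R d ->
    sat (scons (mop (on_mul R) (nm M b) d) e) H' = sat (scons (nm M (on_0 R)) (scons d e)) H.
  move=> hd; have hb := mO_nm hs hM Ob.
  have b0 := one_le_neq0 hs hl hM hb (mle_nm hs hM leb).
  rewrite -(addr0 hs hl hM (mulO hs hl hM hb hd)) block //; first exact: (O0 hs hl hM).
  exact: (neq0_lt hs hl hM).
have f1' : forall1 H' by apply: forall1_fsubst.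
have run : flow R G (finst H' (num L)).
  exists H', L; split=> //.
    rewrite leOE -[on_1 R]nm_std; apply: (one_le hs hl PV_std); first by rewrite -inOE.
    have b0 : b <> nm std_model (on_0 R).
      apply: (one_le_neq0 hs hl PV_std); first by rewrite -inOE.
      by rewrite nm_std -leOE.
    have O0s := O0 hs hl PV_std; have O0i := O0s; rewrite -inOE in O0i.
    have := mul_lt hs hl PV_std (x := b) (y := th1) (z := nm std_model (on_0 R)).
    rewrite (mulr0 hs hl PV_std) -?inOE // => /(_ Ob Oth1 O0i b0) lt eq.
    apply: (lt_irr hs hl PV_std O0s); rewrite -{2}eq; apply: lt.
    apply: (le_lt_trans hs hl PV_std (y := theta)) => //; rewrite -?inOE //.
      by apply: (le0 hs hl PV_std); rewrite -inOE.
    by rewrite /th1 -[on_1 R]nm_std; apply: (lt_succ hs hl PV_std); rewrite -inOE.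
  move=> M hM e.
  have hb := mO_nm hs hM Ob; have l1 := mle_nm hs hM leb.
  have b0 := one_le_neq0 hs hl hM hb l1; have O0m := O0 hs hl hM.
  split; last by rewrite sat_finst value_num.
    (* Position 𝟎 opens block 𝟎, where nothing lies below δ and [K] amounts to [G]. *)
    rewrite -[X in scons X e](mulr0 hs hl hM hb) start //.
    have [<- _ _] := F M hM (scons (nm M (on_0 R)) e); rewrite KE //.
    split=> [hGe|[]//]; split=> //; left=> c hc hc0.
    by case: (le_not_lt hs hl hM O0m hc (le0 hs hl hM hc)).
  move=> x hx x1 _ hyp.
  have x0 := one_le_neq0 hs hl hM hx x1.
  have xE := divide hs hl hM hb hx b0; have hd := divO hs hl hM hx hb b0.
  have rb := div_rem hs hl hM hx hb b0.
  set d := mop (on_div R) x (nm M b) in xE hd rb *.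
  set c := mop (on_sub R) x (mop (on_mul R) (nm M b) d) in xE rb *.
  have hbd := mulO hs hl hM hb hd; have hc : mO R c by apply: (subO hs hl hM).
  have [s p t] := F M hM (scons d e).
  (* A nonzero remainder is an inner position of block [d] and is handled by the steps of [H];
     remainder 𝟎 opens block [d]. *)
  case: (classic (c = nm M (on_0 R))) => c0; last first.
    rewrite xE block //; apply: p => //; first exact: (one_le hs hl hM); first by left.
    move=> c' hc' lt; rewrite -block //; last exact: (lt_trans hs hl hM) rb.
    apply: hyp; first exact: (addO hs hl hM).
    by rewrite xE; apply: (add_lt hs hl hM).
  rewrite c0 (addr0 hs hl hM hbd) in xE.
  have d0 : d <> nm M (on_0 R) by move=> d0; apply: x0; rewrite xE d0 (mulr0 hs hl hM hb).
  rewrite xE start // -s KE //.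
  (* The end [b] of the flow for [d'] has no position of its own in [H'], since b·d' + b already
     opens the next block. It is reached by one more step of [H] from all c' ≺ b, whose positions
     lie below b·d. *)
  have done d' : mO R d' -> mlt R d' d -> sat e G /\ (sat (scons d' e) A \/ sat e D).
    move=> hd' lt; have [s' p' t'] := F M hM (scons d' e).
    apply: K'E; apply/t'; apply: p' => //; first by right.
    move=> c' hc' ltc; rewrite -block //; apply: hyp.
      by apply: (addO hs hl hM) => //; apply: (mulO hs hl hM).
    by rewrite xE; apply: (block_lt hs hl hM).
  (* [G] comes from block 𝟎, which is complete because [d] is nonzero. *)
  split; first by have [] := done _ O0m (neq0_lt hs hl hM hd d0).
  case: (classic (sat e D)) => hDe; [by right|left=> d' hd' lt].
  by have [_ []] := done d' hd' lt.
apply: (flow_trans hs hl run); apply: flow_entails => //.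
- exact: forall1_fsubst.
- by constructor=> //; apply: forall1_fsubst.
- move=> M hM e; rewrite sat_finst value_num /L nm_mop // start //; last exact: (mO_nm hs hM).
  have Ot := mO_nm hs hM Oth; have Ot1 := mO_nm hs hM Oth1.
  have [<- _ _] := F M hM (scons (nm M th1) e); rewrite KE // => -[_ [h|h]]; last by right.
  left; rewrite -/(sat _ _) sat_finst value_num; apply: h => //.
  by rewrite /th1 nm_mop //; apply: (lt_succ hs hl hM).
Qed.

(** * The flow relation as an entailment *)

Definition flows_seq (G D : seq (form pv)) : Prop := flow R (bigAnd G) (bigOr D).

(** [fw_ti] is induction read contrapositively, with δ as eigenvariable. Of the logical rules only
    the one for ∀ is listed, as no ∀₁-formula contains ∃. *)
Inductive flow_wrule : wrule pv -> Prop :=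
| fw_all A : forall1 (All A) -> flow_wrule (all_wrule A)
| fw_ti A theta : forall1 A -> inO R theta ->
    flow_wrule (Wrule [::] [:: finst A (num theta)] [:: Of R (Var 0); below A] [:: A]).

Lemma forall1_bigAnd (G : seq (form pv)) : within (@forall1 pv) G -> forall1 (bigAnd G).
Proof.
elim: G => [|A G IH] h /=; constructor; first by apply: h; left.
by apply: IH => B hB; apply: h; right.
Qed.

Lemma forall1_bigOr (G : seq (form pv)) : within (@forall1 pv) G -> forall1 (bigOr G).
Proof.
elim: G => [|A G IH] h /=; constructor; first by apply: h; left.
by apply: IH => B hB; apply: h; right.
Qed.

Lemma fsubst_bigAnd s (G : seq (form pv)) :
  fsubst s (bigAnd G) = bigAnd (map (fsubst s) G).
Proof. by elim: G => //= A G ->. Qed.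

Lemma fsubst_bigOr s (G : seq (form pv)) :
  fsubst s (bigOr G) = bigOr (map (fsubst s) G).
Proof. by elim: G => //= A G ->. Qed.

Lemma bigAnd_entails (G G' : seq (form pv)) : List.incl G G' ->
  entails (bigAnd G') (bigAnd G).
Proof. by move=> sub M _ e /sat_bigAnd h; apply/sat_bigAnd => A /sub /h. Qed.

Lemma bigOr_entails (D D' : seq (form pv)) : List.incl D D' ->
  entails (bigOr D) (bigOr D').
Proof. by move=> sub M _ e /sat_bigOr [A /sub hA h]; apply/sat_bigOr; exists A. Qed.

Lemma initial_entails (G D : seq (form pv)) : initial G D -> entails (bigAnd G) (bigOr D).
Proof.
case=> {G D} [A||| A B|A B|A B|A B|A B|A B|A t|A t|s t|s t|t|A s t] M _ e /=; try tauto.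
- by move=> [h _]; left; rewrite sat_finst.
- by rewrite sat_finst => -[h _]; left; exists (value e t).
- by rewrite !sat_finst => -[-> [h _]]; left.
Qed.

Lemma flows_entailment : entailment (@forall1 pv) flows_seq flow_wrule.
Proof.
split; try by constructor.
- by move=> A B h; inversion h.
- by move=> A B h; inversion h.
- by move=> A h; inversion h.
- by move=> A h; inversion h.
- exact: forall1_fsubst.
- move=> w [A h|A theta hA _] /=; split=> //; auto; try by inversion h; auto.
  + by apply: within_cons => //; apply: forall1_fsubst.
  + by apply: within_cons; [case: (forall1_Of hs (Var 0))|auto using forall1_below].
- by move=> A h; inversion h.
- move=> G D G' D' hG' hD' sG sD.
  have hG : within (@forall1 pv) G by move=> A /sG /hG'.
  have hD : within (@forall1 pv) D by move=> A /sD /hD'.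
  apply: (flow_conv hs hl); auto using forall1_bigAnd, forall1_bigOr, bigAnd_entails, bigOr_entails.
- move=> A G D hA hG hD h1 h2.
  have fG := forall1_bigAnd hG; have fD := forall1_bigOr hD.
  (* The first flow runs with [G] conjoined, so that [G] is available again for the second; after
     distributing, the second runs with [D] disjoined. *)
  apply: (flow_trans hs hl (B := And (bigOr (A :: D)) (bigAnd G))).
    apply: (flow_conv hs hl) (flow_and hs hl fG h1) => //=;
      try by auto using f1_and, f1_or, f1_top, f1_bot.
  apply: (flow_conv hs hl) (flow_or fD h2) => //=;
      try by auto using f1_and, f1_or, f1_top, f1_bot.
    by move=> M _ e /=; tauto.
  by move=> M _ e /=; tauto.
- move=> s G D _ _ /(flow_subst s); by rewrite fsubst_bigAnd fsubst_bigOr.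
- move=> G D hG hD hi; apply: (flow_entails hs hl);
  auto using forall1_bigAnd, forall1_bigOr, initial_entails.
- move=> w G D hw hG hD; have fG := forall1_bigAnd hG; have fD := forall1_bigOr hD.
  rewrite /flows_seq; case: hw => [A hA|A theta hA hth] /=; last first.
    rewrite -fsubst_bigAnd -fsubst_bigOr => h; exact: flow_ti.
  (* The eigenvariable is quantified along the whole flow. It is not free in the contexts, so ∀
     passes over them, by classical logic in the case of [D]. *)
  rewrite -fsubst_bigAnd -fsubst_bigOr -/(fshift _) -/(fshift _) => /flow_all.
  have hA' : forall1 A by inversion hA.
  apply: (flow_conv hs hl) => //; try by auto 6 using f1_and, f1_or, f1_all, forall1_fshift.
    by move=> M _ e h x; rewrite -/(sat _ _) sat_fshift.
  move=> M _ e /= h; case: (classic (sat e (bigOr D))) => hDe; first by right.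
  by left=> x; have [|] := h x; rewrite ?sat_fshift.
Qed.

Lemma PV_qfree A : PV A -> qfree A.
Proof. by case=> *; try constructor. Qed.

(** Induction is needed for all parameters in [M], while the hypotheses speak about [e] only;
    parameters are therefore named by terms and substituted into [A]. *)
Lemma models_TI M (e : nat -> M) :
  (forall A, forall1 A -> flows_seq [::] [:: A] -> sat e A) ->
  (forall d, exists t, d = value e t) ->
  (forall w, flow_wrule w -> within (sat e) (wr_tr w) ->
     within (fun A => ~ sat e A) (wr_fr w) ->
     exists d, within (sat (scons d e)) (wr_l w) /\
               within (fun A => ~ sat (scons d e) A) (wr_r w)) ->
  models M (TI R).
Proof.
move=> hE onto wit.
have hPV : models M PV.
  move=> A hA e'; have [s hse] := choice _ (fun i => onto (e' i)).
  have -> : e' = fun i => value e (s i) by apply: functional_extensionality.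
  have fA : forall1 (fsubst s A).
    by apply: forall1_fsubst; apply: qfree_forall1; apply: PV_qfree.
  rewrite -sat_fsubst; apply: hE => //.
  (* A substituted axiom of PV is in the class and true in all models of PV, hence the end of a
     trivial flow. *)
  apply: (flow_entails hs hl); [exact: f1_top|by apply: f1_or => //; apply: f1_bot|].
  by move=> N hN f _ /=; left; rewrite sat_fsubst; apply: hN.
move=> _ [A hA|A theta hA hth] e'; first exact: hPV.
have [s hse] := choice _ (fun i => onto (e' i)).
have eE x : sat (scons x e') A = sat (scons x e) (fsubst (up s) A).
  by rewrite sat_fsubst value_up; congr (sat (scons x _)); apply: functional_extensionality.
rewrite /ti_instance sat_Imp sat_finst value_num => /sat_AllO_below prog.
apply: NNPP => hn.
have [||d [hL hR]] := wit _ (fw_ti (forall1_fsubst (up s) hA) hth); first by [].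
  by apply: within_cons => //; rewrite sat_finst value_num -eE.
have := hL _ (or_introl erefl); rewrite sat_Of // => hd.
have /sat_below hb := hL _ (or_intror (or_introl erefl)).
apply: (hR _ (or_introl erefl)); rewrite -eE; apply: prog => // c hc hcd.
by rewrite eE; apply: hb.
Qed.

(** * From provability to flows and back *)

Lemma TI_flow G D : within (@forall1 pv) G -> within (@forall1 pv) D ->
  proves (TI R) (Imp (bigAnd G) (bigOr D)) -> flow R (bigAnd G) (bigOr D).
Proof.
move=> hG hD prf; apply: NNPP => hn.
have [M [e [[hGe hDe] hE onto wit]]] :=
  henkin_model form_code_inj flows_entailment hG hD hn.
have := proves_sound (models_TI hE onto wit) prf e.
by rewrite sat_Imp => /(_ ((sat_bigAnd e G).2 hGe)) /sat_bigOr [A /hDe].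
Qed.

Lemma flow_TI A B : flow R A B -> proves (TI R) (Imp A B).
Proof.
move=> [H [b [f1 Ob leb F]]]; apply: completeness form_code_inj _ => M hM e.
have hPV : models M PV by move=> X hX; apply: hM; apply: ti_pv.
have [s p t] := F M hPV e; rewrite sat_Imp s -t => h0.
(* A flow steps only up to [b]. Above [b] the guard makes [X] true, so [X] is progressive on all of
   [O]. *)
pose X := Or (neg (Le R (Var 0) (num b))) H.
have hb := mO_nm hs hPV Ob.
have XE d : sat (scons d e) X <-> (mle R d (nm M b) -> sat (scons d e) H).
  rewrite -/(Imp _ _) sat_Imp sat_Le // value_num; tauto.
have fX : forall1 X.
  by do ! constructor => //; case: (forall1_Lt hs (Var 0) (num b)).
have := hM _ (ti_ti fX Ob) e; rewrite /ti_instance sat_Imp sat_finst value_num.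
move=> ti; apply: (XE _).1; last by right.
apply: ti; apply/sat_AllO_below => d hd hyp; apply/XE => hdb.
(* The steps of a flow begin at 𝟏; position 𝟎 is supplied by the assumption [A]. *)
case: (classic (d = nm M (on_0 R))) => [-> //|d0].
apply: p => //; first exact: (one_le hs hl hPV).
move=> c hc hcd; have /XE := hyp c hc hcd; apply.
by left; apply: (lt_le_trans hs hl hPV) hdb.
Qed.

Lemma flowsP n G D : fscoped n (bigAnd G) -> fscoped n (bigOr D) ->
  flows R n G D <-> flow R (bigAnd G) (bigOr D).
Proof.
move=> sG sD; split=> [[H [b [[f1 sH] [Ob leb] s p t]]]|[H [b [f1 Ob leb F]]]].
  exists H, b; split=> // M hM e.
  have := proves_sound hM s e; rewrite sat_Iff sat_finst value_num => s'.
  have := proves_sound hM t e; rewrite sat_Iff sat_finst value_num => t'.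
  have := proves_sound hM p e; rewrite sat_AllO // => p'.
  split=> // d hd d1 db hyp; have := p' d hd; rewrite !sat_Imp => h; apply: h.
    by rewrite [sat _ _]/= !sat_Lt // !value_num.
  exact/sat_below.
(* [flows] admits only the parameters x_0, ..., x_{n-1}, whereas a flow composed at a cut may
   mention others. These are set to [zero], which neither end of the flow can notice. The bound is
   [n.+1] because [Var 0] is the position. *)
pose cl i : term pv := if i < n.+1 then Var i else zero.
exists (fsubst cl H), b.
have E M (hM : models M PV) (e : nat -> M) :
    flow_at R e (bigAnd G) (bigOr D) (fsubst cl H) b.
  pose f i := if i < n then e i else nm M 0.
  have HE x : sat (scons x e) (fsubst cl H) = sat (scons x f) H.
    rewrite sat_fsubst; congr sat; apply: functional_extensionality => -[|i] //=.
    by rewrite /cl /f ltnS; case: ltnP => // _; rewrite value_zero.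
  have fE A : fscoped n A -> sat e A = sat f A.
    by move=> hA; apply: (sat_scoped hA) => i hi; rewrite /f hi.
  have [s p t] := F M hM f; split; rewrite ?HE ?fE //.
  move=> d hd d1 db hyp; rewrite HE; apply: p => // c hc hcd.
  by rewrite -HE; apply: hyp.
split=> //.
- split; first exact: forall1_fsubst.
  have [m hm] := ex_fscoped H; apply: (fscoped_fsubst hm) => i _.
  by rewrite /cl; case: ifP => //= _ [].
- apply: PV_complete => M hM e; have [s p t] := E M hM e.
  by rewrite sat_Iff sat_finst value_num.
- apply: PV_complete => M hM e; have [s p t] := E M hM e.
  rewrite sat_AllO // => d hd; rewrite !sat_Imp => h /sat_below; apply: p => //.
    by move: h; rewrite [sat _ _]/= !sat_Lt // !value_num => -[].
  by move: h; rewrite [sat _ _]/= !sat_Lt // !value_num => -[].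
- apply: PV_complete => M hM e; have [s p t] := E M hM e.
  by rewrite sat_Iff sat_finst value_num.
Qed.

End TransfiniteInduction.

Lemma fscoped_bigAnd n (G : seq (form pv)) : within (fscoped n) G -> fscoped n (bigAnd G).
Proof.
elim: G => [|A G IH] h //=; split; first by apply: h; left.
by apply: IH => B hB; apply: h; right.
Qed.

Lemma fscoped_bigOr n (G : seq (form pv)) : within (fscoped n) G -> fscoped n (bigOr G).
Proof.
elim: G => [|A G IH] h //=; split; first by apply: h; left.
by apply: IH => B hB; apply: h; right.
Qed.

Theorem theorem4p11 (alpha : Ord) (R : ord_notation)
    (hR : ptime_representation alpha R)
    (n : nat) (Gamma Delta : seq (form pv))
    (hf1 : forall A, List.In A (Gamma ++ Delta) -> forall1 A)
    (hfv : forall A, List.In A (Gamma ++ Delta) -> fscoped n A) :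
  proves (TI R) (Imp (bigAnd Gamma) (bigOr Delta)) <-> flows R n Gamma Delta.
Proof.
case: hR => _ hs _ hl _.
have inl A : List.In A Gamma -> List.In A (Gamma ++ Delta) by rewrite List.in_app_iff; left.
have inr A : List.In A Delta -> List.In A (Gamma ++ Delta) by rewrite List.in_app_iff; right.
rewrite flowsP //.
- split; last exact: flow_TI.
  by apply: TI_flow => // A hA; apply: hf1; auto.
- by apply: fscoped_bigAnd => A hA; apply: hfv; auto.
- by apply: fscoped_bigOr => A hA; apply: hfv; auto.
Qed.
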